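(* It is provable in $\mathbf{ZF}$ that $\mathbf{IQDI}$ implies each of the following statements: (i) Every infinite Hausdorff space with a well-orderable dense subset admits a denumerable cellular family. (ii) Every infinite Hausdorff space which is also a Baire space admits a denumerable cellular family. (iii) Every infinite Hausdorff space $\mathbf{X}$ such that $Clop(\mathbf{X})$ is infinite admits a denumerable cellular family. (iv) Every infinite zero-dimensional Hausdorff space admits a denumerable cellular family.
   Context: The base theory is $\mathbf{ZF}$, with no form of the axiom of choice assumed. A set is infinite if it is not equipotent with any $n\in\omega$, and denumerable if it is equipotent with $\omega$. $\mathbf{IQDI}$ is the statement: for every infinite set $X$, the set $[X]^{<\omega}$ of all finite subsets of $X$ has a denumerable subset. A cellular family of a topological space is a set of pairwise disjoint non-empty open subsets of it. $Clop(\mathbf{X})$ is the set of all clopen subsets of $\mathbf{X}$. A space is zero-dimensional if it has a base consisting of clopen sets. A Baire space is a space in which the intersection of every countable family of dense open sets is dense. *)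

(* Defs.v *)
From Stdlib Require Import List Arith.

(** "Provable in ZF" is taken literally: derivability, in classical first-order
    logic with equality, from the axioms of ZF.  A statement about Rocq types
    could not express it, since choice is available in the metatheory. *)

(** * First-order logic over the language of set theory *)

(** De Bruijn indices; the only terms are variables. *)
Inductive form : Type :=
| Mem (i j : nat)
| Equ (i j : nat)
| Bot
| Imp (A B : form)
| All (A : form).

Definition up (r : nat -> nat) (i : nat) : nat :=
  match i with 0 => 0 | S i => S (r i) end.

Fixpoint ren (r : nat -> nat) (A : form) : form :=
  match A with
  | Mem i j => Mem (r i) (r j)
  | Equ i j => Equ (r i) (r j)
  | Bot => Bot
  | Imp A B => Imp (ren r A) (ren r B)
  | All A => All (ren (up r) A)
  end.

(** [inst t A] is the body [A] of a quantifier instantiated with variable [t]. *)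
Definition inst (t : nat) (A : form) : form :=
  ren (fun i => match i with 0 => t | S i => i end) A.

(** Classical natural deduction. *)
Inductive prv : list form -> form -> Prop :=
| prv_ctx G A : In A G -> prv G A
| prv_impI G A B : prv (A :: G) B -> prv G (Imp A B)
| prv_impE G A B : prv G (Imp A B) -> prv G A -> prv G B
| prv_raa G A : prv (Imp A Bot :: G) Bot -> prv G A
| prv_allI G A : prv (map (ren S) G) A -> prv G (All A)
| prv_allE G A t : prv G (All A) -> prv G (inst t A)
| prv_refl G t : prv G (Equ t t)
| prv_subst G A s t : prv G (Equ s t) -> prv G (inst s A) -> prv G (inst t A).

(** All free variables of [A] have index below [fvbound A]. *)
Fixpoint fvbound (A : form) : nat :=
  match A with
  | Mem i j | Equ i j => Nat.max (S i) (S j)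
  | Bot => 0
  | Imp A B => Nat.max (fvbound A) (fvbound B)
  | All A => pred (fvbound A)
  end.

Definition univ_closure (A : form) : form := Nat.iter (fvbound A) All A.

(** * A surface syntax with genuine binders *)

(** A surface formula is a formula depending on the number [d] of enclosing
    quantifiers.  A surface variable is a de Bruijn level: the number of
    quantifiers enclosing its binder.  Under [d] quantifiers, level [x] has
    index [d - 1 - x]; a closed surface formula is read at [d = 0]. *)
Definition sform : Type := nat -> form.

Definition idx (d x : nat) : nat := d - 1 - x.

Definition sMem (x y : nat) : sform := fun d => Mem (idx d x) (idx d y).
Definition sEqu (x y : nat) : sform := fun d => Equ (idx d x) (idx d y).
Definition sBot : sform := fun _ => Bot.
Definition sImp (A B : sform) : sform := fun d => Imp (A d) (B d).
Definition sAll (A : nat -> sform) : sform := fun d => All (A d (S d)).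

Definition sNot (A : sform) : sform := sImp A sBot.
Definition sAnd (A B : sform) : sform := sNot (sImp A (sNot B)).
Definition sOr (A B : sform) : sform := sImp (sNot A) B.
Definition sIff (A B : sform) : sform := sAnd (sImp A B) (sImp B A).
Definition sEx (A : nat -> sform) : sform := sNot (sAll (fun x => sNot (A x))).

Declare Scope fol_scope.
Delimit Scope fol_scope with fol.
Bind Scope fol_scope with sform.

Notation "x ∈ y" := (sMem x y) (at level 70, no associativity) : fol_scope.
Notation "x ≐ y" := (sEqu x y) (at level 70, no associativity) : fol_scope.
Notation "¬ A" := (sNot A) (at level 75, right associativity) : fol_scope.
Notation "A ∧ B" := (sAnd A B) (at level 80, right associativity) : fol_scope.
Notation "A ∨ B" := (sOr A B) (at level 85, right associativity) : fol_scope.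
Notation "A ⇒ B" := (sImp A B) (at level 90, right associativity) : fol_scope.
Notation "A ⇔ B" := (sIff A B) (at level 95, no associativity) : fol_scope.
Notation "∀ x .. y , A" := (sAll (fun x => .. (sAll (fun y => A%fol)) ..))
  (at level 200, x binder, y binder, right associativity) : fol_scope.
Notation "∃ x .. y , A" := (sEx (fun x => .. (sEx (fun y => A%fol)) ..))
  (at level 200, x binder, y binder, right associativity) : fol_scope.

Open Scope fol_scope.

Definition sAllIn (a : nat) (A : nat -> sform) : sform := ∀ x, x ∈ a ⇒ A x.
Definition sExIn (a : nat) (A : nat -> sform) : sform := ∃ x, x ∈ a ∧ A x.
Definition sExUnique (A : nat -> sform) : sform := ∃ z, ∀ y, A y ⇔ y ≐ z.

(** [sapp A l] is [A] with its variables of index [0, 1, ...] replaced by the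
    surface variables in [l], the remaining ones staying free parameters. *)
Definition sapp (A : form) (l : list nat) : sform := fun d =>
  ren (fun i => match nth_error l i with
                | Some x => idx d x
                | None => d + (i - length l)
                end) A.

(** * The axioms of ZF *)

Definition subset (x y : nat) : sform := ∀ z, z ∈ x ⇒ z ∈ y.
Definition is_empty (x : nat) : sform := ∀ z, ¬ z ∈ x.
Definition is_pair (p x y : nat) : sform := ∀ z, z ∈ p ⇔ z ≐ x ∨ z ≐ y.
Definition is_union (u x : nat) : sform := ∀ z, z ∈ u ⇔ sExIn x (fun y => z ∈ y).
Definition is_power (p x : nat) : sform := ∀ z, z ∈ p ⇔ subset z x.
Definition is_succ (s x : nat) : sform := ∀ z, z ∈ s ⇔ z ∈ x ∨ z ≐ x.
Definition disjoint (x y : nat) : sform := ¬ sExIn x (fun z => z ∈ y).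
Definition inductive (w : nat) : sform :=
  sExIn w is_empty ∧ sAllIn w (fun x => sExIn w (fun s => is_succ s x)).

Definition ax_extensionality : sform :=
  ∀ x y, (∀ z, z ∈ x ⇔ z ∈ y) ⇒ x ≐ y.
Definition ax_foundation : sform :=
  ∀ x, ¬ is_empty x ⇒ sExIn x (fun y => disjoint y x).
Definition ax_pairing : sform := ∀ x y, ∃ p, is_pair p x y.
Definition ax_union : sform := ∀ x, ∃ u, is_union u x.
Definition ax_power : sform := ∀ x, ∃ p, is_power p x.
Definition ax_infinity : sform := ∃ w, inductive w.

(** In [A], index 0 is the element [x], index 1 the set [a]; all others are
    parameters.  In particular [b] does not occur in [A]. *)
Definition ax_separation (A : form) : sform :=
  ∀ a, ∃ b, ∀ x, x ∈ b ⇔ x ∈ a ∧ sapp A (x :: a :: nil).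

(** In [A], index 0 is the value [y], index 1 the argument [x], index 2 the
    set [a]; all others are parameters. *)
Definition ax_replacement (A : form) : sform :=
  ∀ a, sAllIn a (fun x => sExUnique (fun y => sapp A (y :: x :: a :: nil))) ⇒
    ∃ b, ∀ y, y ∈ b ⇔ sExIn a (fun x => sapp A (y :: x :: a :: nil)).

Inductive ZF : form -> Prop :=
| ZF_extensionality : ZF (ax_extensionality 0)
| ZF_foundation : ZF (ax_foundation 0)
| ZF_pairing : ZF (ax_pairing 0)
| ZF_union : ZF (ax_union 0)
| ZF_power : ZF (ax_power 0)
| ZF_infinity : ZF (ax_infinity 0)
| ZF_separation A : ZF (univ_closure (ax_separation A 0))
| ZF_replacement A : ZF (univ_closure (ax_replacement A 0)).

Definition ZF_proves (A : sform) : Prop :=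
  exists G : list form, (forall B, In B G -> ZF B) /\ prv G (A 0).

(** * Set-theoretic notions *)

(** Kuratowski pairs: [p = {{x}, {x, y}}]. *)
Definition is_opair (p x y : nat) : sform :=
  ∃ s t, is_pair s x x ∧ is_pair t x y ∧ is_pair p s t.

Definition related (f x y : nat) : sform := sExIn f (fun p => is_opair p x y).

Definition relation_between (f X Y : nat) : sform :=
  sAllIn f (fun p => sExIn X (fun x => sExIn Y (fun y => is_opair p x y))).

Definition bijection (f X Y : nat) : sform :=
  relation_between f X Y
  ∧ sAllIn X (fun x => sExUnique (fun y => y ∈ Y ∧ related f x y))
  ∧ sAllIn Y (fun y => sExUnique (fun x => x ∈ X ∧ related f x y)).

Definition equipotent (X Y : nat) : sform := ∃ f, bijection f X Y.

Definition is_omega (w : nat) : sform :=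
  inductive w ∧ ∀ v, inductive v ⇒ subset w v.

Definition finite (X : nat) : sform :=
  ∃ w, is_omega w ∧ sExIn w (fun n => equipotent X n).
Definition infinite (X : nat) : sform := ¬ finite X.
Definition denumerable (X : nat) : sform := ∃ w, is_omega w ∧ equipotent X w.
Definition countable (X : nat) : sform := finite X ∨ denumerable X.

Definition is_finite_subsets (F X : nat) : sform :=
  ∀ s, s ∈ F ⇔ subset s X ∧ finite s.

Definition well_orders (R D : nat) : sform :=
  relation_between R D D
  ∧ sAllIn D (fun x => related R x x)
  ∧ sAllIn D (fun x => sAllIn D (fun y =>
      related R x y ∧ related R y x ⇒ x ≐ y))
  ∧ sAllIn D (fun x => sAllIn D (fun y => sAllIn D (fun z =>
      related R x y ∧ related R y z ⇒ related R x z)))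
  ∧ sAllIn D (fun x => sAllIn D (fun y => related R x y ∨ related R y x))
  ∧ (∀ E, subset E D ∧ ¬ is_empty E ⇒
       sExIn E (fun m => sAllIn E (fun x => related R m x))).

Definition well_orderable (D : nat) : sform := ∃ R, well_orders R D.

Definition IQDI : sform :=
  ∀ X F, infinite X ∧ is_finite_subsets F X ⇒
    ∃ D, subset D F ∧ denumerable D.

(** * Topology: [X] is the underlying set, [T] the family of open sets *)

Definition topology (X T : nat) : sform :=
  sAllIn T (fun U => subset U X)
  ∧ sExIn T is_empty
  ∧ X ∈ T
  ∧ sAllIn T (fun U => sAllIn T (fun V => sExIn T (fun W =>
      ∀ z, z ∈ W ⇔ z ∈ U ∧ z ∈ V)))
  ∧ (∀ S, subset S T ⇒ sExIn T (fun W => is_union W S)).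

Definition hausdorff (X T : nat) : sform :=
  sAllIn X (fun x => sAllIn X (fun y => ¬ x ≐ y ⇒
    sExIn T (fun U => sExIn T (fun V => x ∈ U ∧ y ∈ V ∧ disjoint U V)))).

Definition infinite_hausdorff_space (X T : nat) : sform :=
  topology X T ∧ hausdorff X T ∧ infinite X.

Definition dense (X T D : nat) : sform :=
  subset D X ∧ sAllIn T (fun U => ¬ is_empty U ⇒ ¬ disjoint U D).

(** The intersection of [G] is taken within [X], so that of the empty family
    is [X]. *)
Definition baire (X T : nat) : sform :=
  ∀ G, countable G ∧ sAllIn G (fun U => U ∈ T ∧ dense X T U) ⇒
    ∀ I, (∀ x, x ∈ I ⇔ x ∈ X ∧ sAllIn G (fun U => x ∈ U)) ⇒ dense X T I.

Definition clopen (X T U : nat) : sform :=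
  U ∈ T ∧ sExIn T (fun V => ∀ z, z ∈ V ⇔ z ∈ X ∧ ¬ z ∈ U).

Definition is_Clop (K X T : nat) : sform := ∀ U, U ∈ K ⇔ clopen X T U.

Definition base (T B : nat) : sform :=
  subset B T ∧ sAllIn T (fun U => ∃ S, subset S B ∧ is_union U S).

Definition zero_dimensional (X T : nat) : sform :=
  ∃ B, base T B ∧ sAllIn B (fun U => clopen X T U).

Definition cellular_family (T C : nat) : sform :=
  sAllIn C (fun U => U ∈ T ∧ ¬ is_empty U)
  ∧ sAllIn C (fun U => sAllIn C (fun V => ¬ U ≐ V ⇒ disjoint U V)).

Definition admits_denumerable_cellular_family (T : nat) : sform :=
  ∃ C, cellular_family T C ∧ denumerable C.

Definition well_orderable_dense_case : sform :=
  ∀ X T, infinite_hausdorff_space X T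
    ∧ (∃ D, dense X T D ∧ well_orderable D)
    ⇒ admits_denumerable_cellular_family T.

Definition baire_case : sform :=
  ∀ X T, infinite_hausdorff_space X T ∧ baire X T
    ⇒ admits_denumerable_cellular_family T.

Definition infinite_Clop_case : sform :=
  ∀ X T, infinite_hausdorff_space X T
    ∧ (∃ K, is_Clop K X T ∧ infinite K)
    ⇒ admits_denumerable_cellular_family T.

Definition zero_dimensional_case : sform :=
  ∀ X T, infinite_hausdorff_space X T ∧ zero_dimensional X T
    ⇒ admits_denumerable_cellular_family T.

(* Main.v *)
From Stdlib Require Import List Arith Lia Cantor.
From Stdlib Require Import Classical ClassicalEpsilon.
From Stdlib Require Import FunctionalExtensionality PropExtensionality ProofIrrelevance.
Require Import Defs.

(** By Gödel's completeness theorem it suffices to argue in an arbitrary model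
    of ZF, taking care that Separation is applied to definable predicates only.

    Let Q be an infinite set of regular open sets: all of them, or all clopen
    ones.  By IQDI there are distinct finite subsets F(0), F(1), ... of Q.  Off
    the boundaries of the finitely many members of F(0), ..., F(n), which is an
    open dense set, the space splits into finitely many regular open cells of
    level n, and the cells of level n + 1 refine them.  A cell is stable if no
    member of any F(i) splits it; since the F(i) are distinct, every level has an
    unstable cell.  A decreasing sequence of regular open sets that is not
    eventually constant yields a denumerable cellular family, namely the gaps
    between the distinct terms.  The exteriors of the stable parts of the levels
    form such a sequence, unless they are eventually equal to a non-empty open
    set O inside which all cells are unstable.  In that case any branch of cells
    through O is such a sequence.  A branch is given by a point of O lying off
    all the boundaries, which exists if the members of Q are clopen or if the
    space is Baire, and otherwise by recursion along a well-ordered dense set. *)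

(** * Completeness of natural deduction *)

(** Choice is available in the metatheory but not inside a model, where every set and function has
    to come from a formula with parameters. This is why functions on a model are maps [f : M -> M]
    with definable graph ([Fun1], [Fun2]), why selections are definite descriptions or least
    elements, and why induction and recursion run over the possibly nonstandard [omega] of the model
    instead of [nat]. Completeness is proved with models all of whose elements are named by
    variables, so that one fixed environment carries every parameter.

    Without choice one cannot in general pick, level after level, an unstable cell inside the
    previous one. Hence the region O: where all cells are unstable, any settled points will do, and
    only their selection remains. Regularity of the open sets is what makes gaps non-empty: if V is
    regular and U is an open set not contained in V, then U is not contained in the closure of V
    either. *)

Definition scons {X : Type} (x : X) (r : nat -> X) (i : nat) : X :=
  match i with 0 => x | S j => r j end.

Fixpoint sat {M : Type} (E : M -> M -> Prop) (r : nat -> M) (A : form) : Prop :=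
  match A with
  | Mem i j => E (r i) (r j)
  | Equ i j => r i = r j
  | Bot => False
  | Imp A B => sat E r A -> sat E r B
  | All A => forall x, sat E (scons x r) A
  end.

(** * Satisfaction, renaming and free variables *)

Lemma sat_ext {M : Type} (E : M -> M -> Prop) A r r' :
  (forall i, r i = r' i) -> sat E r A <-> sat E r' A.
Proof.
  intro H; replace r' with r by (apply functional_extensionality; exact H); tauto.
Qed.

Lemma sat_ren {M : Type} (E : M -> M -> Prop) A :
  forall (r : nat -> M) s, sat E r (ren s A) <-> sat E (fun i => r (s i)) A.
Proof.
  induction A as [i j|i j| |A IHA B IHB|A IHA]; intros r s; simpl; try tauto.
  - rewrite IHA, IHB; tauto.
  - split; intros H x.
    + generalize (H x); rewrite IHA; apply sat_ext; intros [|i]; reflexivity.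
    + apply IHA; generalize (H x); apply sat_ext; intros [|i]; reflexivity.
Qed.

Lemma ren_agree A : forall r s,
  (forall i, i < fvbound A -> r i = s i) -> ren r A = ren s A.
Proof.
  induction A as [i j|i j| |A IHA B IHB|A IHA]; intros r s H; cbn [ren];
    cbn [fvbound] in H; auto.
  - rewrite (H i), (H j) by lia; reflexivity.
  - rewrite (H i), (H j) by lia; reflexivity.
  - rewrite (IHA r s), (IHB r s); auto; intros; apply H; lia.
  - f_equal; apply IHA; intros [|i] Hi; simpl; auto; f_equal; apply H; lia.
Qed.

Lemma ren_id A : ren (fun i => i) A = A.
Proof.
  assert (H : forall B r, (forall i, r i = i) -> ren r B = B).
  { induction B as [i j|i j| |B IHB C IHC|B IHB]; intros r H; simpl; auto;
      try (rewrite !H; reflexivity).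
    - rewrite IHB, IHC; auto.
    - f_equal; apply IHB; intros [|i]; simpl; auto. }
  apply H; reflexivity.
Qed.

Lemma ren_ren A : forall r s, ren r (ren s A) = ren (fun i => r (s i)) A.
Proof.
  induction A as [i j|i j| |A IHA B IHB|A IHA]; intros r s; simpl; auto.
  - rewrite IHA, IHB; reflexivity.
  - f_equal; rewrite IHA; apply ren_agree; intros [|i] _; reflexivity.
Qed.

Lemma ren_inst r t A : ren r (inst t A) = inst (r t) (ren (up r) A).
Proof.
  unfold inst; rewrite !ren_ren; apply ren_agree; intros [|i] _; reflexivity.
Qed.

Lemma inst_ren_up r t A : inst t (ren (up r) A) = ren (scons t r) A.
Proof.
  unfold inst; rewrite ren_ren; apply ren_agree; intros [|i] _; reflexivity.
Qed.

Lemma fvbound_ren A : forall r k,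
  (forall i, i < fvbound A -> r i < k) -> fvbound (ren r A) <= k.
Proof.
  induction A as [i j|i j| |A IHA B IHB|A IHA]; intros r k H;
    cbn [ren fvbound] in *.
  - assert (r i < k) by (apply H; lia); assert (r j < k) by (apply H; lia); lia.
  - assert (r i < k) by (apply H; lia); assert (r j < k) by (apply H; lia); lia.
  - lia.
  - assert (fvbound (ren r A) <= k) by (apply IHA; intros; apply H; lia).
    assert (fvbound (ren r B) <= k) by (apply IHB; intros; apply H; lia).
    lia.
  - assert (fvbound (ren (up r) A) <= S k); [|lia].
    apply IHA; intros [|i] Hi; simpl; [lia|].
    assert (r i < k) by (apply H; lia); lia.
Qed.

Lemma fvbound_inst t A : fvbound (inst t A) <= Nat.max (S t) (fvbound A).
Proof. apply fvbound_ren; intros [|i] Hi; lia. Qed.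

Lemma fvbound_univ_closure A : fvbound (univ_closure A) = 0.
Proof.
  assert (H : forall n, fvbound (Nat.iter n All A) = fvbound A - n).
  { induction n as [|n IH]; simpl; [lia|]; rewrite IH; lia. }
  unfold univ_closure; rewrite H; lia.
Qed.

Lemma sat_univ_closure {M : Type} (E : M -> M -> Prop) A :
  (forall r, sat E r (univ_closure A)) -> forall r : nat -> M, sat E r A.
Proof.
  unfold univ_closure; generalize (fvbound A) as n.
  induction n as [|n IH]; simpl; intro H; [exact H|].
  apply IH; intro r; generalize (H (fun i => r (S i)) (r 0)).
  apply sat_ext; intros [|i]; reflexivity.
Qed.

(** * Structural rules of natural deduction *)

Lemma prv_weaken G A : prv G A -> forall G', incl G G' -> prv G' A.
Proof.
  induction 1 as [G A H|G A B H IH|G A B H IH H' IH'|G A H IH|G A H IH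
    |G A t H IH|G t|G A s t H IH H' IH']; intros G' HG.
  - apply prv_ctx, HG, H.
  - apply prv_impI, IH; intros C [->|HC]; [left; reflexivity|right; auto].
  - eapply prv_impE; eauto.
  - apply prv_raa, IH; intros C [->|HC]; [left; reflexivity|right; auto].
  - apply prv_allI, IH, incl_map, HG.
  - apply prv_allE; auto.
  - apply prv_refl.
  - eapply prv_subst; eauto.
Qed.

Lemma prv_ren G A : prv G A -> forall r, prv (map (ren r) G) (ren r A).
Proof.
  induction 1 as [G A H|G A B H IH|G A B H IH H' IH'|G A H IH|G A H IH
    |G A t H IH|G t|G A s t H IH H' IH']; intros r; simpl.
  - apply prv_ctx, in_map, H.
  - apply prv_impI, IH.
  - eapply prv_impE; [apply IH|apply IH'].
  - apply prv_raa, IH.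
  - apply prv_allI.
    replace (map (ren S) (map (ren r) G))
      with (map (ren (up r)) (map (ren S) G)); [apply IH|].
    rewrite !map_map; apply map_ext; intro B; rewrite !ren_ren.
    apply ren_agree; reflexivity.
  - rewrite ren_inst; apply prv_allE, IH.
  - apply prv_refl.
  - rewrite ren_inst; eapply prv_subst; [apply IH|].
    rewrite <- ren_inst; apply IH'.
Qed.

(** Generalization over an eigenvariable. The variable [t] is free neither in [G] nor in [All A], so
    the renaming that sends [t] to 0 and shifts all else turns [inst t A] back into [A] and acts on
    [G] as the shift demanded by [prv_allI]. *)
Lemma prv_gen G A t :
  (forall B, In B G -> fvbound B <= t) -> fvbound A <= S t ->
  prv G (inst t A) -> prv G (All A).
Proof.
  intros HG HA H; apply prv_allI.
  set (r := fun i => if i =? t then 0 else S i).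
  replace (map (ren S) G) with (map (ren r) G).
  - replace A with (ren r (inst t A)); [apply prv_ren, H|].
    unfold inst; rewrite ren_ren, <- (ren_id A) at 1.
    rewrite ren_id; rewrite <- (ren_id A) at 2; apply ren_agree.
    unfold r; intros [|i] Hi; [rewrite Nat.eqb_refl; reflexivity|].
    destruct (Nat.eqb_spec i t); lia.
  - apply map_ext_in; intros B HB; apply ren_agree; intros i Hi.
    specialize (HG B HB); unfold r; destruct (Nat.eqb_spec i t); lia.
Qed.

(** * Enumeration of formulas *)

Fixpoint decode (fuel n : nat) : form :=
  match fuel with
  | 0 => Bot
  | S f =>
    let (k, m) := of_nat n in
    let (a, b) := of_nat m in
    match k with
    | 0 => Mem a b
    | 1 => Equ a b
    | 2 => Imp (decode f a) (decode f b)
    | 3 => All (decode f a)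
    | _ => Bot
    end
  end.

(** Codes are nested Cantor pairs, a tag followed by two arguments. The fuel is read off the number
    too, so surjectivity needs only that some fuel is large enough. *)
Definition enum_form (n : nat) : form := let (f, m) := of_nat n in decode f m.

Lemma enum_form_surj A : exists n, enum_form n = A.
Proof.
  assert (H : exists m d, forall f, d <= f -> decode f m = A).
  { induction A as [i j|i j| |A [a [d Ha]] B [b [d' Hb]]|A [a [d Ha]]].
    - exists (to_nat (0, to_nat (i, j))), 1; intros [|f] Hf; [lia|].
      cbn [decode]; rewrite !cancel_of_to; reflexivity.
    - exists (to_nat (1, to_nat (i, j))), 1; intros [|f] Hf; [lia|].
      cbn [decode]; rewrite !cancel_of_to; reflexivity.
    - exists (to_nat (4, to_nat (0, 0))), 1; intros [|f] Hf; [lia|].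
      cbn [decode]; rewrite !cancel_of_to; reflexivity.
    - exists (to_nat (2, to_nat (a, b))), (S (d + d')); intros [|f] Hf; [lia|].
      cbn [decode]; rewrite !cancel_of_to, Ha, Hb by lia; reflexivity.
    - exists (to_nat (3, to_nat (a, 0))), (S d); intros [|f] Hf; [lia|].
      cbn [decode]; rewrite !cancel_of_to, Ha by lia; reflexivity. }
  destruct H as [m [d H]]; exists (to_nat (d, m)).
  unfold enum_form; rewrite cancel_of_to; apply H; lia.
Qed.

(** * Theories, consistency and maximal Henkin extensions *)

Definition thy (T : form -> Prop) (A : form) : Prop :=
  exists G, (forall B, In B G -> T B) /\ prv G A.
Definition add (A : form) (T : form -> Prop) (B : form) : Prop := B = A \/ T B.
Definition con (T : form -> Prop) : Prop := ~ thy T Bot.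
Definition bounded (T : form -> Prop) (k : nat) : Prop :=
  forall B, T B -> fvbound B <= k.

Lemma thy_ax (T : form -> Prop) A : T A -> thy T A.
Proof.
  intro H; exists (A :: nil); split; [intros B [<-|[]]; exact H|].
  apply prv_ctx; left; reflexivity.
Qed.

Lemma thy_mono (T T' : form -> Prop) A :
  (forall B, T B -> T' B) -> thy T A -> thy T' A.
Proof. intros H [G [HG HA]]; exists G; auto. Qed.

Lemma thy_mp T A B : thy T (Imp A B) -> thy T A -> thy T B.
Proof.
  intros [G [HG H]] [G' [HG' H']]; exists (G ++ G'); split.
  - intros C HC; apply in_app_or in HC; destruct HC; auto.
  - eapply prv_impE; eapply prv_weaken; eauto.
    + apply incl_appl, incl_refl.
    + apply incl_appr, incl_refl.
Qed.

Lemma thy_deduct T A B : thy (add A T) B -> thy T (Imp A B).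
Proof.
  intros [G [HG H]].
  assert (HG' : exists G', (forall C, In C G' -> T C) /\ incl G (A :: G')).
  { clear H; induction G as [|C G IH].
    - exists nil; split; [intros C []|intros C []].
    - destruct IH as [G' [H1 H2]]; [intros; apply HG; right; assumption|].
      destruct (HG C) as [->|HC]; [left; reflexivity| |].
      + exists G'; split; auto.
        intros C' [<-|HC']; [left; reflexivity|apply H2, HC'].
      + exists (C :: G'); split; [intros C' [<-|HC']; auto|].
        intros C' [<-|HC']; [right; left; reflexivity|].
        destruct (H2 C' HC') as [<-|]; [left|right; right]; auto. }
  destruct HG' as [G' [H1 H2]]; exists G'; split; auto.
  apply prv_impI; eapply prv_weaken; eauto.
Qed.

Lemma thy_raa T A : thy (add (Imp A Bot) T) Bot -> thy T A.
Proof.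
  intro H; apply thy_deduct in H; destruct H as [G [HG H]]; exists G; split; auto.
  apply prv_raa; eapply prv_impE.
  - eapply prv_weaken; [exact H|apply incl_tl, incl_refl].
  - apply prv_ctx; left; reflexivity.
Qed.

(** If the witness made the theory inconsistent, the theory would prove [inst t C], hence [All C]
    since [t] is fresh, against its member [Imp (All C) Bot]. *)
Lemma con_add_witness T C t :
  con (add (Imp (All C) Bot) T) -> bounded (add (Imp (All C) Bot) T) t ->
  con (add (Imp (inst t C) Bot) (add (Imp (All C) Bot) T)).
Proof.
  intros Hc Hb H; apply Hc; apply thy_raa in H.
  apply thy_mp with (All C); [apply thy_ax; left; reflexivity|].
  destruct H as [G [HG H]]; exists G; split; auto.
  apply prv_gen with t; auto.
  assert (H0 := Hb _ (or_introl eq_refl)); cbn [fvbound] in H0; lia.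
Qed.

(** The Henkin witness of a negated universal is the free variable [fresh]. *)
Definition fresh (T : form -> Prop) : nat :=
  epsilon (inhabits 0) (bounded T).

(** A Lindenbaum step and a Henkin step in one: a negated universal enters together with its
    witness. Consistency is undecidable, so it is a clause of the membership predicate. *)
Definition step (T : form -> Prop) (A B : form) : Prop :=
  T B \/ con (add A T) /\
    (B = A \/ exists C, A = Imp (All C) Bot /\
                B = Imp (inst (fresh (add A T)) C) Bot).

Lemma bounded_add T A k :
  bounded T k -> bounded (add A T) (Nat.max k (fvbound A)).
Proof. intros H B [->|HB]; [lia|]; specialize (H B HB); lia. Qed.

(** A step adds at most two formulas, so a fresh variable remains for the next step. *)
Lemma bounded_step T A : (exists k, bounded T k) -> exists k, bounded (step T A) k.
Proof.
  intros [k Hk]; exists (k + fvbound A + S (fresh (add A T))).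
  intros B [HB|[_ [->|[C [-> ->]]]]].
  - specialize (Hk B HB); lia.
  - lia.
  - set (t := fresh _); cbn [fvbound]; assert (H := fvbound_inst t C); lia.
Qed.

Lemma con_step T A : (exists k, bounded T k) -> con T -> con (step T A).
Proof.
  intros [k Hk] HT.
  destruct (classic (con (add A T))) as [HA|HA].
  - destruct (classic (exists C, A = Imp (All C) Bot)) as [[C HC]|HC].
    + assert (Hf : bounded (add A T) (fresh (add A T))).
      { unfold fresh; apply epsilon_spec; eexists; apply bounded_add, Hk. }
      rewrite HC in HA, Hf.
      assert (H := con_add_witness T C _ HA Hf).
      intro H'; apply H; revert H'; apply thy_mono.
      intros B [HB|[_ [->|[C' [E' ->]]]]].
      * right; right; exact HB.
      * right; left; exact HC.
      * left; rewrite HC in E' |- *; injection E' as <-; reflexivity.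
    + intro H; apply HA; revert H; apply thy_mono.
      intros B [HB|[_ [->|[C [E' _]]]]]; [right|left|]; auto.
      destruct HC; exists C; exact E'.
  - intro H; apply HT; revert H; apply thy_mono; intros B [HB|[H _]]; tauto.
Qed.

Section Henkin.
Variable T0 : form -> Prop.
Hypothesis T0_closed : bounded T0 0.
Hypothesis T0_con : con T0.

Fixpoint stage (n : nat) : form -> Prop :=
  match n with 0 => T0 | S n => step (stage n) (enum_form n) end.

Definition limit (A : form) : Prop := exists n, stage n A.

Lemma stage_ok n : (exists k, bounded (stage n) k) /\ con (stage n).
Proof.
  induction n as [|n [IH1 IH2]]; simpl.
  - split; [exists 0; exact T0_closed|exact T0_con].
  - split; [apply bounded_step|apply con_step]; auto.
Qed.

Lemma stage_mono n m A : n <= m -> stage n A -> stage m A.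
Proof. induction 1; [auto|]; intro; left; auto. Qed.

Lemma limit_con : con limit.
Proof.
  intros [G [HG H]].
  assert (HG' : exists n, forall B, In B G -> stage n B).
  { clear H; induction G as [|C G IH]; [exists 0; intros B []|].
    destruct IH as [n Hn]; [intros; apply HG; right; assumption|].
    destruct (HG C (or_introl eq_refl)) as [m Hm]; exists (n + m).
    intros B [<-|HB]; [apply stage_mono with m|apply stage_mono with n];
      auto; lia. }
  destruct HG' as [n Hn]; apply (stage_ok n); exists G; auto.
Qed.

Lemma limit_max A : con (add A limit) -> limit A.
Proof.
  intro H; destruct (enum_form_surj A) as [n Hn]; exists (S n); simpl; right.
  rewrite Hn; split; [|left; reflexivity].
  intro H'; apply H; revert H'; apply thy_mono.
  intros B [->|HB]; [left|right; exists n]; auto.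
Qed.

Lemma limit_thy A : thy limit A -> limit A.
Proof.
  intro H; apply limit_max; intro H'; apply limit_con.
  apply thy_mp with A; auto; apply thy_deduct, H'.
Qed.

Lemma limit_neg A : ~ limit A -> limit (Imp A Bot).
Proof.
  intro H; apply limit_thy, thy_deduct; apply NNPP; intro H'.
  apply H, limit_max, H'.
Qed.

Lemma limit_imp A B : limit (Imp A B) <-> (limit A -> limit B).
Proof.
  split.
  - intros H HA; apply limit_thy; apply thy_mp with A; apply thy_ax; auto.
  - intro H; destruct (classic (limit A)) as [HA|HA].
    + apply limit_thy, thy_deduct; apply thy_mono with limit.
      * intros; right; auto.
      * apply thy_ax; auto.
    + apply limit_neg in HA; apply limit_thy, thy_deduct.
      apply thy_raa; apply thy_mp with A.
      * apply thy_ax; right; right; exact HA.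
      * apply thy_ax; right; left; reflexivity.
Qed.

(** For the converse, a missing [All A] has its negation in the limit; at the stage where that
    negation is enumerated, a witness refuting one instance was added. *)
Lemma limit_all A : limit (All A) <-> forall t, limit (inst t A).
Proof.
  split.
  - intros H t; apply limit_thy.
    destruct (thy_ax _ _ H) as [G [HG HA]]; exists G; split; auto.
    apply prv_allE, HA.
  - intro H; apply NNPP; intro H'; apply limit_neg in H'.
    destruct (enum_form_surj (Imp (All A) Bot)) as [n Hn].
    set (t := fresh (add (Imp (All A) Bot) (stage n))).
    assert (Ht : limit (Imp (inst t A) Bot)).
    { exists (S n); simpl; right; rewrite Hn; split.
      - intro Hc; apply limit_con; apply thy_mp with (Imp (All A) Bot).
        + apply thy_deduct; revert Hc; apply thy_mono.
          intros B [->|HB]; [left|right; exists n]; auto.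
        + apply thy_ax, H'.
      - right; exists A; auto. }
    apply limit_con; apply thy_mp with (inst t A); apply thy_ax; auto.
Qed.

Lemma limit_subst A s t : limit (Equ s t) -> limit (inst s A) -> limit (inst t A).
Proof.
  intros H H'; apply limit_thy.
  exists (Equ s t :: inst s A :: nil); split.
  - intros B [<-|[<-|[]]]; auto.
  - apply prv_subst with s; apply prv_ctx; simpl; auto.
Qed.

Lemma limit_refl t : limit (Equ t t).
Proof. apply limit_thy; exists nil; split; [intros B []|apply prv_refl]. Qed.

Lemma limit_sym s t : limit (Equ s t) -> limit (Equ t s).
Proof.
  intro H; apply (limit_subst (Equ 0 (S s)) s t H); apply limit_refl.
Qed.

Lemma limit_trans s t u : limit (Equ s t) -> limit (Equ t u) -> limit (Equ s u).
Proof.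
  intros H H'; apply (limit_subst (Equ (S s) 0) t u H' H).
Qed.

(** * The term model *)

Definition carrier : Type :=
  {P : nat -> Prop | exists s, P = fun t => limit (Equ s t)}.

(** Taking the equivalence class of a variable as a predicate turns provable equality into equality
    in the carrier, as [sat] requires for [Equ]. *)
Definition class (s : nat) : carrier :=
  exist _ (fun t => limit (Equ s t)) (ex_intro _ s eq_refl).

Definition cmem (x y : carrier) : Prop :=
  exists s t, x = class s /\ y = class t /\ limit (Mem s t).

Lemma class_surj x : exists n, class n = x.
Proof.
  destruct x as [P [s Hs]]; exists s; unfold class; subst P.
  f_equal; apply proof_irrelevance.
Qed.

Lemma class_eq s t : class s = class t <-> limit (Equ s t).
Proof.
  split.
  - intro H; apply (f_equal (@proj1_sig _ _)) in H; simpl in H.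
    rewrite (equal_f H t); apply limit_refl.
  - intro H; unfold class; apply subset_eq_compat.
    apply functional_extensionality; intro u; apply propositional_extensionality.
    split; intro H'; eapply limit_trans; eauto; apply limit_sym; auto.
Qed.

Lemma class_mem s t : cmem (class s) (class t) <-> limit (Mem s t).
Proof.
  split; [|intro H; exists s, t; auto].
  intros [s' [t' [Hs [Ht H]]]]; apply class_eq in Hs, Ht.
  apply (limit_subst (Mem 0 (S t)) s' s); [apply limit_sym, Hs|].
  apply (limit_subst (Mem (S s') 0) t' t); [apply limit_sym, Ht|exact H].
Qed.

Lemma truth A : forall r : nat -> nat,
  sat cmem (fun i => class (r i)) A <-> limit (ren r A).
Proof.
  induction A as [i j|i j| |A IHA B IHB|A IHA]; intro r; simpl.
  - apply class_mem.
  - apply class_eq.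
  - split; [tauto|]; intro H; apply limit_con, thy_ax, H.
  - rewrite limit_imp, IHA, IHB; tauto.
  - rewrite limit_all; split.
    + intros H t; rewrite inst_ren_up; apply IHA.
      generalize (H (class t)); apply sat_ext; intros [|i]; reflexivity.
    + intros H x; destruct (class_surj x) as [t <-].
      specialize (H t); rewrite inst_ren_up in H; apply IHA in H; revert H.
      apply sat_ext; intros [|i]; reflexivity.
Qed.

End Henkin.

(** Only models enumerated by some [c] have to be checked, because the term model consists of
    classes of variables. The axioms have to be closed so that all variables are free to serve as
    witnesses. *)
Theorem completeness (T : form -> Prop) (A : form) :
  bounded T 0 -> fvbound A = 0 ->
  (forall (M : Type) (E : M -> M -> Prop) (c : nat -> M),
     (forall x, exists n, c n = x) ->
     (forall B, T B -> forall r, sat E r B) -> forall r, sat E r A) ->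
  thy T A.
Proof.
  intros HT HA H; apply thy_raa; apply NNPP; intro Hc.
  set (T0 := add (Imp A Bot) T).
  assert (Hb : bounded T0 0).
  { intros B [->|HB]; [cbn [fvbound]; lia|auto]. }
  assert (closed : forall B, T0 B -> forall r, sat (cmem T0) r B).
  { intros B HB r.
    assert (HB' : forall s, ren s B = B).
    { intro s; rewrite <- (ren_id B) at 2; apply ren_agree; specialize (Hb B HB); lia. }
    (* The lemma [truth] speaks of environments that factor through [class]; an arbitrary one does
       after a choice of representatives. *)
    assert (Hs : exists s : nat -> nat, forall i, class T0 (s i) = r i).
    { exists (fun i => epsilon (inhabits 0) (fun n => class T0 n = r i)).
      intro i; apply epsilon_spec, class_surj. }
    destruct Hs as [s Hs].
    rewrite (sat_ext _ B r (fun i => class T0 (s i))) by (intro; symmetry; auto).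
    apply (truth T0 Hb Hc B s); rewrite HB'; exists 0; exact HB. }
  apply (closed (Imp A Bot) (or_introl eq_refl) (fun i => class T0 i)).
  apply (H _ (cmem T0) (class T0)).
  - apply class_surj.
  - intros B HB; apply closed; right; exact HB.
Qed.

(** * The notions of set theory and topology in a structure *)

Section Model.
Variable M : Type.
Variable E : M -> M -> Prop.

Definition Subset (x y : M) : Prop :=
  forall z, E z x -> E z y.
Definition Empty (x : M) : Prop :=
  forall z, ~ E z x.
Definition IsPair (p x y : M) : Prop :=
  forall z, E z p <-> z = x \/ z = y.
Definition IsUnion (u x : M) : Prop :=
  forall z, E z u <-> exists y, E y x /\ E z y.
Definition IsPower (p x : M) : Prop :=
  forall z, E z p <-> Subset z x.
Definition IsSucc (s x : M) : Prop :=
  forall z, E z s <-> E z x \/ z = x.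
Definition Disjoint (x y : M) : Prop :=
  ~ exists z, E z x /\ E z y.
Definition IsInductive (w : M) : Prop :=
  (exists x, E x w /\ Empty x) /\
  forall x, E x w -> exists s, E s w /\ IsSucc s x.
Definition IsOpair (p x y : M) : Prop :=
  exists s t, IsPair s x x /\ IsPair t x y /\ IsPair p s t.
Definition Related (f x y : M) : Prop :=
  exists p, E p f /\ IsOpair p x y.
Definition RelationBetween (f X Y : M) : Prop :=
  forall p, E p f -> exists x, E x X /\ exists y, E y Y /\ IsOpair p x y.
Definition Bijection (f X Y : M) : Prop :=
  RelationBetween f X Y
  /\ (forall x, E x X -> exists z, forall y, E y Y /\ Related f x y <-> y = z)
  /\ (forall y, E y Y -> exists z, forall x, E x X /\ Related f x y <-> x = z).
Definition Equipotent (X Y : M) : Prop :=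
  exists f, Bijection f X Y.
Definition IsOmega (w : M) : Prop :=
  IsInductive w /\ forall v, IsInductive v -> Subset w v.
Definition Finite (X : M) : Prop :=
  exists w, IsOmega w /\ exists n, E n w /\ Equipotent X n.
Definition Infinite (X : M) : Prop :=
  ~ Finite X.
Definition Denumerable (X : M) : Prop :=
  exists w, IsOmega w /\ Equipotent X w.
Definition Countable (X : M) : Prop :=
  Finite X \/ Denumerable X.
Definition IsFiniteSubsets (F X : M) : Prop :=
  forall s, E s F <-> Subset s X /\ Finite s.
Definition WellOrders (R D : M) : Prop :=
  RelationBetween R D D
  /\ (forall x, E x D -> Related R x x)
  /\ (forall x, E x D -> forall y, E y D ->
       Related R x y /\ Related R y x -> x = y)
  /\ (forall x, E x D -> forall y, E y D -> forall z, E z D ->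
       Related R x y /\ Related R y z -> Related R x z)
  /\ (forall x, E x D -> forall y, E y D -> Related R x y \/ Related R y x)
  /\ (forall S, Subset S D /\ ~ Empty S ->
       exists m, E m S /\ forall x, E x S -> Related R m x).
Definition WellOrderable (D : M) : Prop :=
  exists R, WellOrders R D.
Definition HoldsIQDI : Prop :=
  forall X F, Infinite X /\ IsFiniteSubsets F X ->
  exists D, Subset D F /\ Denumerable D.
Definition Topology (X T : M) : Prop :=
  (forall U, E U T -> Subset U X)
  /\ (exists U, E U T /\ Empty U)
  /\ E X T
  /\ (forall U, E U T -> forall V, E V T ->
       exists W, E W T /\ forall z, E z W <-> E z U /\ E z V)
  /\ (forall S, Subset S T -> exists W, E W T /\ IsUnion W S).
Definition Hausdorff (X T : M) : Prop :=
  forall x, E x X -> forall y, E y X -> ~ x = y ->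
  exists U, E U T /\ exists V, E V T /\ E x U /\ E y V /\ Disjoint U V.
Definition InfiniteHausdorff (X T : M) : Prop :=
  Topology X T /\ Hausdorff X T /\ Infinite X.
Definition Dense (X T D : M) : Prop :=
  Subset D X /\ forall U, E U T -> ~ Empty U -> ~ Disjoint U D.
Definition Baire (X T : M) : Prop :=
  forall G, Countable G /\ (forall U, E U G -> E U T /\ Dense X T U) ->
  forall I, (forall x, E x I <-> E x X /\ forall U, E U G -> E x U) -> Dense X T I.
Definition Clopen (X T U : M) : Prop :=
  E U T /\ exists V, E V T /\ forall z, E z V <-> E z X /\ ~ E z U.
Definition IsClop (K X T : M) : Prop :=
  forall U, E U K <-> Clopen X T U.
Definition Base (T B : M) : Prop :=
  Subset B T /\ forall U, E U T -> exists S, Subset S B /\ IsUnion U S.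
Definition ZeroDimensional (X T : M) : Prop :=
  exists B, Base T B /\ forall U, E U B -> Clopen X T U.
Definition Cellular (T C : M) : Prop :=
  (forall U, E U C -> E U T /\ ~ Empty U)
  /\ (forall U, E U C -> forall V, E V C -> ~ U = V -> Disjoint U V).
Definition DenumerablyCellular (T : M) : Prop :=
  exists C, Cellular T C /\ Denumerable C.
Definition WellOrderableDenseCase : Prop :=
  forall X T, InfiniteHausdorff X T /\ (exists D, Dense X T D /\ WellOrderable D) ->
  DenumerablyCellular T.
Definition BaireCase : Prop :=
  forall X T, InfiniteHausdorff X T /\ Baire X T -> DenumerablyCellular T.
Definition InfiniteClopCase : Prop :=
  forall X T, InfiniteHausdorff X T /\ (exists K, IsClop K X T /\ Infinite K) ->
  DenumerablyCellular T.
Definition ZeroDimensionalCase : Prop :=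
  forall X T, InfiniteHausdorff X T /\ ZeroDimensional X T ->
  DenumerablyCellular T.

(** * Satisfaction of surface formulas *)

Definition at_level (r : nat -> M) (d x : nat) (u : M) : Prop :=
  x < d /\ r (idx d x) = u.

Lemma at_level_new r d u : at_level (scons u r) (S d) d u.
Proof.
  split; [lia|]; unfold idx; replace (S d - 1 - d) with 0 by lia; reflexivity.
Qed.

(** Levels do not change under a further quantifier while indices shift; the bound [x < d] protects
    the truncated subtraction in [idx]. *)
Lemma at_level_old r d x u v : at_level r d x u -> at_level (scons v r) (S d) x u.
Proof.
  intros [H <-]; split; [lia|]; unfold idx.
  replace (S d - 1 - x) with (S (d - 1 - x)) by lia; reflexivity.
Qed.

Lemma sat_sMem r d x y u v : at_level r d x u -> at_level r d y v ->
  sat E r (sMem x y d) <-> E u v.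
Proof. intros [_ <-] [_ <-]; reflexivity. Qed.

Lemma sat_sEqu r d x y u v : at_level r d x u -> at_level r d y v ->
  sat E r (sEqu x y d) <-> u = v.
Proof. intros [_ <-] [_ <-]; reflexivity. Qed.

Lemma sat_sImp r d A B P Q : (sat E r (A d) <-> P) -> (sat E r (B d) <-> Q) ->
  sat E r (sImp A B d) <-> (P -> Q).
Proof. cbn; tauto. Qed.

Lemma sat_sNot r d A P : (sat E r (A d) <-> P) -> sat E r (sNot A d) <-> ~ P.
Proof. cbn; tauto. Qed.

Lemma sat_sAnd r d A B P Q : (sat E r (A d) <-> P) -> (sat E r (B d) <-> Q) ->
  sat E r (sAnd A B d) <-> P /\ Q.
Proof. cbn; tauto. Qed.

Lemma sat_sOr r d A B P Q : (sat E r (A d) <-> P) -> (sat E r (B d) <-> Q) ->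
  sat E r (sOr A B d) <-> P \/ Q.
Proof. cbn; tauto. Qed.

Lemma sat_sIff r d A B P Q : (sat E r (A d) <-> P) -> (sat E r (B d) <-> Q) ->
  sat E r (sIff A B d) <-> (P <-> Q).
Proof. cbn; tauto. Qed.

Lemma sat_sAll r d (A : nat -> sform) (P : M -> Prop) :
  (forall v, sat E (scons v r) (A d (S d)) <-> P v) ->
  sat E r (sAll A d) <-> forall v, P v.
Proof. intro H; split; intros H' v; apply H, H'. Qed.

Lemma sat_sEx r d (A : nat -> sform) (P : M -> Prop) :
  (forall v, sat E (scons v r) (A d (S d)) <-> P v) ->
  sat E r (sEx A d) <-> exists v, P v.
Proof.
  intro H; unfold sEx; rewrite (sat_sNot _ _ _ (forall v, ~ P v)).
  - split; [|intros [v Hv] H'; exact (H' v Hv)].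
    intro H'; apply NNPP; intro H1; apply H'; intros v Hv; apply H1; eauto.
  - apply sat_sAll; intro v; apply sat_sNot, H.
Qed.

Lemma sat_sAllIn r d a u (A : nat -> sform) (P : M -> Prop) :
  at_level r d a u ->
  (forall v, sat E (scons v r) (A d (S d)) <-> P v) ->
  sat E r (sAllIn a A d) <-> forall v, E v u -> P v.
Proof.
  intros Ha H; apply sat_sAll; intro v; apply sat_sImp; [apply sat_sMem|apply H].
  - apply at_level_new.
  - apply at_level_old, Ha.
Qed.

Lemma sat_sExIn r d a u (A : nat -> sform) (P : M -> Prop) :
  at_level r d a u ->
  (forall v, sat E (scons v r) (A d (S d)) <-> P v) ->
  sat E r (sExIn a A d) <-> exists v, E v u /\ P v.
Proof.
  intros Ha H; apply sat_sEx; intro v; apply sat_sAnd; [apply sat_sMem|apply H].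
  - apply at_level_new.
  - apply at_level_old, Ha.
Qed.

Lemma sat_sExUnique r d (A : nat -> sform) (P : M -> Prop) :
  (forall z v, sat E (scons v (scons z r)) (A (S d) (S (S d))) <-> P v) ->
  sat E r (sExUnique A d) <-> exists z, forall v, P v <-> v = z.
Proof.
  intro H; apply sat_sEx; intro z; apply sat_sAll; intro v; apply sat_sIff.
  - apply H.
  - apply sat_sEqu; [apply at_level_new|apply at_level_old, at_level_new].
Qed.

Create HintDb sem.
#[local] Hint Resolve at_level_new at_level_old : sem.

(** Follows the structure of a surface formula; a named notion is closed by its own lemma,
    registered as a hint once proved. *)
Ltac sem :=
  cbv beta;
  lazymatch goal with
  | |- forall _, _ => intro; sem
  | |- at_level _ _ _ _ => eauto 40 with sem nocore
  | |- sat _ _ (sMem _ _ _) <-> _ => apply sat_sMem; sem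
  | |- sat _ _ (sEqu _ _ _) <-> _ => apply sat_sEqu; sem
  | |- sat _ _ (sImp _ _ _) <-> _ => apply sat_sImp; sem
  | |- sat _ _ (sNot _ _) <-> _ => apply sat_sNot; sem
  | |- sat _ _ (sAnd _ _ _) <-> _ => apply sat_sAnd; sem
  | |- sat _ _ (sOr _ _ _) <-> _ => apply sat_sOr; sem
  | |- sat _ _ (sIff _ _ _) <-> _ => apply sat_sIff; sem
  | |- sat _ _ (sAll _ _) <-> _ => apply sat_sAll; sem
  | |- sat _ _ (sEx _ _) <-> _ => apply sat_sEx; sem
  | |- sat _ _ (sAllIn _ _ _) <-> _ => apply sat_sAllIn; sem
  | |- sat _ _ (sExIn _ _ _) <-> _ => apply sat_sExIn; sem
  | |- sat _ _ (sExUnique _ _) <-> _ => apply sat_sExUnique; sem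
  | |- _ => eauto 40 with sem nocore
  end.

Tactic Notation "start_sem" reference(a) reference(b) :=
  intros; unfold a, b; sem.

Lemma sat_subset r d i_x i_y x y :
  at_level r d i_x x ->
  at_level r d i_y y ->
  sat E r (subset i_x i_y d) <-> Subset x y.
Proof. start_sem subset Subset. Qed.
#[local] Hint Resolve sat_subset : sem.

Lemma sat_is_empty r d i_x x :
  at_level r d i_x x ->
  sat E r (is_empty i_x d) <-> Empty x.
Proof. start_sem is_empty Empty. Qed.
#[local] Hint Resolve sat_is_empty : sem.

Lemma sat_is_pair r d i_p i_x i_y p x y :
  at_level r d i_p p ->
  at_level r d i_x x ->
  at_level r d i_y y ->
  sat E r (is_pair i_p i_x i_y d) <-> IsPair p x y.
Proof. start_sem is_pair IsPair. Qed.
#[local] Hint Resolve sat_is_pair : sem.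

Lemma sat_is_union r d i_u i_x u x :
  at_level r d i_u u ->
  at_level r d i_x x ->
  sat E r (is_union i_u i_x d) <-> IsUnion u x.
Proof. start_sem is_union IsUnion. Qed.
#[local] Hint Resolve sat_is_union : sem.

Lemma sat_is_power r d i_p i_x p x :
  at_level r d i_p p ->
  at_level r d i_x x ->
  sat E r (is_power i_p i_x d) <-> IsPower p x.
Proof. start_sem is_power IsPower. Qed.
#[local] Hint Resolve sat_is_power : sem.

Lemma sat_is_succ r d i_s i_x s x :
  at_level r d i_s s ->
  at_level r d i_x x ->
  sat E r (is_succ i_s i_x d) <-> IsSucc s x.
Proof. start_sem is_succ IsSucc. Qed.
#[local] Hint Resolve sat_is_succ : sem.

Lemma sat_disjoint r d i_x i_y x y :
  at_level r d i_x x ->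
  at_level r d i_y y ->
  sat E r (disjoint i_x i_y d) <-> Disjoint x y.
Proof. start_sem disjoint Disjoint. Qed.
#[local] Hint Resolve sat_disjoint : sem.

Lemma sat_inductive r d i_w w :
  at_level r d i_w w ->
  sat E r (inductive i_w d) <-> IsInductive w.
Proof. start_sem inductive IsInductive. Qed.
#[local] Hint Resolve sat_inductive : sem.

Lemma sat_is_opair r d i_p i_x i_y p x y :
  at_level r d i_p p ->
  at_level r d i_x x ->
  at_level r d i_y y ->
  sat E r (is_opair i_p i_x i_y d) <-> IsOpair p x y.
Proof. start_sem is_opair IsOpair. Qed.
#[local] Hint Resolve sat_is_opair : sem.

Lemma sat_related r d i_f i_x i_y f x y :
  at_level r d i_f f ->
  at_level r d i_x x ->
  at_level r d i_y y ->
  sat E r (related i_f i_x i_y d) <-> Related f x y.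
Proof. start_sem related Related. Qed.
#[local] Hint Resolve sat_related : sem.

Lemma sat_relation_between r d i_f i_X i_Y f X Y :
  at_level r d i_f f ->
  at_level r d i_X X ->
  at_level r d i_Y Y ->
  sat E r (relation_between i_f i_X i_Y d) <-> RelationBetween f X Y.
Proof. start_sem relation_between RelationBetween. Qed.
#[local] Hint Resolve sat_relation_between : sem.

Lemma sat_bijection r d i_f i_X i_Y f X Y :
  at_level r d i_f f ->
  at_level r d i_X X ->
  at_level r d i_Y Y ->
  sat E r (bijection i_f i_X i_Y d) <-> Bijection f X Y.
Proof. start_sem bijection Bijection. Qed.
#[local] Hint Resolve sat_bijection : sem.

Lemma sat_equipotent r d i_X i_Y X Y :
  at_level r d i_X X ->
  at_level r d i_Y Y ->
  sat E r (equipotent i_X i_Y d) <-> Equipotent X Y.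
Proof. start_sem equipotent Equipotent. Qed.
#[local] Hint Resolve sat_equipotent : sem.

Lemma sat_is_omega r d i_w w :
  at_level r d i_w w ->
  sat E r (is_omega i_w d) <-> IsOmega w.
Proof. start_sem is_omega IsOmega. Qed.
#[local] Hint Resolve sat_is_omega : sem.

Lemma sat_finite r d i_X X :
  at_level r d i_X X ->
  sat E r (finite i_X d) <-> Finite X.
Proof. start_sem finite Finite. Qed.
#[local] Hint Resolve sat_finite : sem.

Lemma sat_infinite r d i_X X :
  at_level r d i_X X ->
  sat E r (infinite i_X d) <-> Infinite X.
Proof. start_sem infinite Infinite. Qed.
#[local] Hint Resolve sat_infinite : sem.

Lemma sat_denumerable r d i_X X :
  at_level r d i_X X ->
  sat E r (denumerable i_X d) <-> Denumerable X.
Proof. start_sem denumerable Denumerable. Qed.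
#[local] Hint Resolve sat_denumerable : sem.

Lemma sat_countable r d i_X X :
  at_level r d i_X X ->
  sat E r (countable i_X d) <-> Countable X.
Proof. start_sem countable Countable. Qed.
#[local] Hint Resolve sat_countable : sem.

Lemma sat_is_finite_subsets r d i_F i_X F X :
  at_level r d i_F F ->
  at_level r d i_X X ->
  sat E r (is_finite_subsets i_F i_X d) <-> IsFiniteSubsets F X.
Proof. start_sem is_finite_subsets IsFiniteSubsets. Qed.
#[local] Hint Resolve sat_is_finite_subsets : sem.

Lemma sat_well_orders r d i_R i_D R D :
  at_level r d i_R R ->
  at_level r d i_D D ->
  sat E r (well_orders i_R i_D d) <-> WellOrders R D.
Proof. start_sem well_orders WellOrders. Qed.
#[local] Hint Resolve sat_well_orders : sem.

Lemma sat_well_orderable r d i_D D :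
  at_level r d i_D D ->
  sat E r (well_orderable i_D d) <-> WellOrderable D.
Proof. start_sem well_orderable WellOrderable. Qed.
#[local] Hint Resolve sat_well_orderable : sem.

Lemma sat_IQDI r d  :
  sat E r (IQDI  d) <-> HoldsIQDI .
Proof. start_sem IQDI HoldsIQDI. Qed.
#[local] Hint Resolve sat_IQDI : sem.

Lemma sat_topology r d i_X i_T X T :
  at_level r d i_X X ->
  at_level r d i_T T ->
  sat E r (topology i_X i_T d) <-> Topology X T.
Proof. start_sem topology Topology. Qed.
#[local] Hint Resolve sat_topology : sem.

Lemma sat_hausdorff r d i_X i_T X T :
  at_level r d i_X X ->
  at_level r d i_T T ->
  sat E r (hausdorff i_X i_T d) <-> Hausdorff X T.
Proof. start_sem hausdorff Hausdorff. Qed.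
#[local] Hint Resolve sat_hausdorff : sem.

Lemma sat_infinite_hausdorff_space r d i_X i_T X T :
  at_level r d i_X X ->
  at_level r d i_T T ->
  sat E r (infinite_hausdorff_space i_X i_T d) <-> InfiniteHausdorff X T.
Proof. start_sem infinite_hausdorff_space InfiniteHausdorff. Qed.
#[local] Hint Resolve sat_infinite_hausdorff_space : sem.

Lemma sat_dense r d i_X i_T i_D X T D :
  at_level r d i_X X ->
  at_level r d i_T T ->
  at_level r d i_D D ->
  sat E r (dense i_X i_T i_D d) <-> Dense X T D.
Proof. start_sem dense Dense. Qed.
#[local] Hint Resolve sat_dense : sem.

Lemma sat_baire r d i_X i_T X T :
  at_level r d i_X X ->
  at_level r d i_T T ->
  sat E r (baire i_X i_T d) <-> Baire X T.
Proof. start_sem baire Baire. Qed.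
#[local] Hint Resolve sat_baire : sem.

Lemma sat_clopen r d i_X i_T i_U X T U :
  at_level r d i_X X ->
  at_level r d i_T T ->
  at_level r d i_U U ->
  sat E r (clopen i_X i_T i_U d) <-> Clopen X T U.
Proof. start_sem clopen Clopen. Qed.
#[local] Hint Resolve sat_clopen : sem.

Lemma sat_is_Clop r d i_K i_X i_T K X T :
  at_level r d i_K K ->
  at_level r d i_X X ->
  at_level r d i_T T ->
  sat E r (is_Clop i_K i_X i_T d) <-> IsClop K X T.
Proof. start_sem is_Clop IsClop. Qed.
#[local] Hint Resolve sat_is_Clop : sem.

Lemma sat_base r d i_T i_B T B :
  at_level r d i_T T ->
  at_level r d i_B B ->
  sat E r (base i_T i_B d) <-> Base T B.
Proof. start_sem base Base. Qed.
#[local] Hint Resolve sat_base : sem.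

Lemma sat_zero_dimensional r d i_X i_T X T :
  at_level r d i_X X ->
  at_level r d i_T T ->
  sat E r (zero_dimensional i_X i_T d) <-> ZeroDimensional X T.
Proof. start_sem zero_dimensional ZeroDimensional. Qed.
#[local] Hint Resolve sat_zero_dimensional : sem.

Lemma sat_cellular_family r d i_T i_C T C :
  at_level r d i_T T ->
  at_level r d i_C C ->
  sat E r (cellular_family i_T i_C d) <-> Cellular T C.
Proof. start_sem cellular_family Cellular. Qed.
#[local] Hint Resolve sat_cellular_family : sem.

Lemma sat_admits_denumerable_cellular_family r d i_T T :
  at_level r d i_T T ->
  sat E r (admits_denumerable_cellular_family i_T d) <-> DenumerablyCellular T.
Proof. start_sem admits_denumerable_cellular_family DenumerablyCellular. Qed.
#[local] Hint Resolve sat_admits_denumerable_cellular_family : sem.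

Lemma sat_well_orderable_dense_case r d  :
  sat E r (well_orderable_dense_case  d) <-> WellOrderableDenseCase .
Proof. start_sem well_orderable_dense_case WellOrderableDenseCase. Qed.
#[local] Hint Resolve sat_well_orderable_dense_case : sem.

Lemma sat_baire_case r d  :
  sat E r (baire_case  d) <-> BaireCase .
Proof. start_sem baire_case BaireCase. Qed.
#[local] Hint Resolve sat_baire_case : sem.

Lemma sat_infinite_Clop_case r d  :
  sat E r (infinite_Clop_case  d) <-> InfiniteClopCase .
Proof. start_sem infinite_Clop_case InfiniteClopCase. Qed.
#[local] Hint Resolve sat_infinite_Clop_case : sem.

Lemma sat_zero_dimensional_case r d  :
  sat E r (zero_dimensional_case  d) <-> ZeroDimensionalCase .
Proof. start_sem zero_dimensional_case ZeroDimensionalCase. Qed.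
#[local] Hint Resolve sat_zero_dimensional_case : sem.

Lemma sat_extensionality r : sat E r (ax_extensionality 0) <->
  forall x y, (forall z, E z x <-> E z y) -> x = y.
Proof. unfold ax_extensionality; sem. Qed.

Lemma sat_pairing r : sat E r (ax_pairing 0) <-> forall x y, exists p, IsPair p x y.
Proof. unfold ax_pairing; sem. Qed.

Lemma sat_union r : sat E r (ax_union 0) <-> forall x, exists u, IsUnion u x.
Proof. unfold ax_union; sem. Qed.

Lemma sat_power r : sat E r (ax_power 0) <-> forall x, exists p, IsPower p x.
Proof. unfold ax_power; sem. Qed.

Lemma sat_infinity r : sat E r (ax_infinity 0) <-> exists w, IsInductive w.
Proof. unfold ax_infinity; sem. Qed.

(** * Definability with parameters *)

Variable c : nat -> M.
Hypothesis c_surj : forall x, exists n, c n = x.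

Definition interleave {Y : Type} (f g : nat -> Y) (i : nat) : Y :=
  if Nat.even i then f (Nat.div2 i) else g (Nat.div2 i).

Lemma interleave_even {Y : Type} (f g : nat -> Y) i : interleave f g (2 * i) = f i.
Proof.
  unfold interleave; rewrite Nat.even_mul, Nat.div2_double; reflexivity.
Qed.

Lemma interleave_odd {Y : Type} (f g : nat -> Y) i : interleave f g (S (2 * i)) = g i.
Proof.
  unfold interleave; rewrite Nat.even_succ, Nat.odd_mul, Nat.div2_succ_double.
  reflexivity.
Qed.

Lemma interleave_comp {Y Z : Type} (h : Y -> Z) f g i :
  h (interleave f g i) = interleave (fun j => h (f j)) (fun j => h (g j)) i.
Proof. unfold interleave; destruct (Nat.even i); reflexivity. Qed.

(** The even variables of the defining formula are the arguments and the odd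
    ones run through the whole model, so that parameters come for free. *)
Definition Def (P : (nat -> M) -> Prop) : Prop :=
  exists A, forall r, P r <-> sat E (interleave r c) A.

Definition DefT (t : (nat -> M) -> M) : Prop :=
  Def (fun r => r 0 = t (fun i => r (S i))).

Definition Def1 (P : M -> Prop) : Prop := Def (fun r => P (r 0)).
Definition Def2 (P : M -> M -> Prop) : Prop := Def (fun r => P (r 0) (r 1)).
Definition Def3 (P : M -> M -> M -> Prop) : Prop :=
  Def (fun r => P (r 0) (r 1) (r 2)).
Definition Fun1 (f : M -> M) : Prop := Def (fun r => r 0 = f (r 1)).
Definition Fun2 (f : M -> M -> M) : Prop := Def (fun r => r 0 = f (r 1) (r 2)).

Lemma Def_iff P P' : (forall r, P r <-> P' r) -> Def P -> Def P'.
Proof. intros H [A HA]; exists A; intro r; rewrite <- H; apply HA. Qed.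

Definition code (x : M) : nat := epsilon (inhabits 0) (fun n => c n = x).

Lemma code_spec x : c (code x) = x.
Proof. unfold code; apply epsilon_spec, c_surj. Qed.

(** An argument may be replaced by another argument or by a fixed element. Both are renamings, since
    every element sits at some odd variable. *)
Lemma Def_ren P (s : nat -> nat + M) : Def P ->
  Def (fun r => P (fun i => match s i with inl j => r j | inr a => a end)).
Proof.
  intros [A HA].
  exists (ren (interleave
    (fun i => match s i with inl j => 2 * j | inr a => S (2 * code a) end)
    (fun i => S (2 * i))) A).
  intro r; rewrite sat_ren, HA; apply sat_ext; intro i.
  rewrite (interleave_comp (interleave r c)).
  unfold interleave at 1 2; destruct (Nat.even i).
  - destruct (s (Nat.div2 i)) as [j|a].
    + rewrite interleave_even; reflexivity.
    + rewrite interleave_odd, code_spec; reflexivity.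
  - rewrite interleave_odd; reflexivity.
Qed.

Lemma Def_imp P Q : Def P -> Def Q -> Def (fun r => P r -> Q r).
Proof.
  intros [A HA] [B HB]; exists (Imp A B); intro r; simpl.
  rewrite <- HA, <- HB; tauto.
Qed.

Lemma Def_False : Def (fun _ => False).
Proof. exists Bot; simpl; tauto. Qed.

Lemma Def_all (P : M -> (nat -> M) -> Prop) :
  Def (fun r => P (r 0) (fun i => r (S i))) -> Def (fun r => forall x, P x r).
Proof.
  intros [A HA].
  (* Under the new binder the interleaved environment has moved up by one: argument 0 is the bound
     variable, argument j + 1 has index 2j + 1, and parameter i has index 2i + 2. *)
  exists (All (ren (interleave
    (fun i => match i with 0 => 0 | S j => S (2 * j) end)
    (fun i => S (S (2 * i)))) A)).
  intro r; cbn [sat].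
  assert (H : forall x, P x r <-> sat E (interleave (scons x r) c) A).
  { intro x; rewrite <- HA; reflexivity. }
  assert (H' : forall x, sat E (interleave (scons x r) c) A <->
    sat E (scons x (interleave r c)) (ren (interleave
    (fun i => match i with 0 => 0 | S j => S (2 * j) end)
    (fun i => S (S (2 * i)))) A)).
  { intro x; rewrite sat_ren; apply sat_ext; intro i.
    rewrite (interleave_comp (scons x (interleave r c))).
    unfold interleave at 1 2; destruct (Nat.even i).
    - destruct (Nat.div2 i) as [|j]; [reflexivity|].
      symmetry; apply (interleave_even r c).
    - symmetry; apply (interleave_odd r c). }
  split; intros H1 x; [apply H', H, H1|apply H, H', H1].
Qed.

Lemma Def_not P : Def P -> Def (fun r => ~ P r).
Proof. intro H; apply Def_imp; [exact H|apply Def_False]. Qed.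

Lemma Def_and P Q : Def P -> Def Q -> Def (fun r => P r /\ Q r).
Proof.
  intros HP HQ; apply Def_iff with (fun r => ~ (P r -> ~ Q r)).
  - intro r; tauto.
  - apply Def_not, Def_imp, Def_not; auto.
Qed.

Lemma Def_or P Q : Def P -> Def Q -> Def (fun r => P r \/ Q r).
Proof.
  intros HP HQ; apply Def_iff with (fun r => ~ P r -> Q r).
  - intro r; tauto.
  - apply Def_imp; [apply Def_not|]; auto.
Qed.

Lemma Def_equiv P Q : Def P -> Def Q -> Def (fun r => P r <-> Q r).
Proof. intros HP HQ; apply Def_and; apply Def_imp; auto. Qed.

Lemma Def_ex (P : M -> (nat -> M) -> Prop) :
  Def (fun r => P (r 0) (fun i => r (S i))) -> Def (fun r => exists x, P x r).
Proof.
  intro H; apply Def_iff with (fun r => ~ forall x, ~ P x r).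
  - intro r; split; [|intros [x Hx] H'; exact (H' x Hx)].
    intro H'; apply NNPP; intro H1; apply H'; eauto.
  - apply Def_not, (Def_all (fun x r => ~ P x r)), Def_not, H.
Qed.

Lemma Def_eq_var : Def (fun r => r 0 = r 1).
Proof. exists (Equ 0 2); intro r; reflexivity. Qed.

Lemma Def_mem_var : Def (fun r => E (r 0) (r 1)).
Proof. exists (Mem 0 2); intro r; reflexivity. Qed.

Lemma DefT_var i : DefT (fun r => r i).
Proof.
  apply (Def_ren (fun r => r 0 = r 1)
    (fun j => match j with 0 => inl 0 | _ => inl (S i) end)), Def_eq_var.
Qed.

Lemma DefT_const a : DefT (fun _ => a).
Proof.
  apply (Def_ren (fun r => r 0 = r 1)
    (fun j => match j with 0 => inl 0 | _ => inr a end)), Def_eq_var.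
Qed.

Lemma DefT_shift t : DefT t -> DefT (fun r => t (fun i => r (S i))).
Proof.
  intro H; apply (Def_ren (fun r => r 0 = t (fun i => r (S i)))
    (fun j => match j with 0 => inl 0 | S i => inl (S (S i)) end)), H.
Qed.

Lemma Def_subst (P : M -> (nat -> M) -> Prop) t : DefT t ->
  Def (fun r => P (r 0) (fun i => r (S i))) -> Def (fun r => P (t r) r).
Proof.
  intros Ht HP; apply Def_iff with (fun r => forall x, x = t r -> P x r).
  - intro r; split; [intro H; apply H; reflexivity|intros H x ->; exact H].
  - apply (Def_all (fun x r => x = t r -> P x r)), Def_imp; auto.
Qed.

Lemma Def_app1 R t : Def1 R -> DefT t -> Def (fun r => R (t r)).
Proof. intros HR Ht; apply (Def_subst (fun x r => R x)); auto. Qed.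

Lemma Def_app2 R t u : Def2 R -> DefT t -> DefT u -> Def (fun r => R (t r) (u r)).
Proof.
  intros HR Ht Hu; apply (Def_subst (fun x r => R x (u r))); auto.
  apply (Def_subst (fun y r => R (r 0) y)); [apply DefT_shift, Hu|].
  apply (Def_ren (fun r => R (r 0) (r 1))
    (fun j => match j with 0 => inl 1 | _ => inl 0 end)), HR.
Qed.

Lemma Def_app3 R t u v : Def3 R -> DefT t -> DefT u -> DefT v ->
  Def (fun r => R (t r) (u r) (v r)).
Proof.
  intros HR Ht Hu Hv; apply (Def_subst (fun x r => R x (u r) (v r))); auto.
  apply (Def_subst (fun y r => R (r 0) y (v (fun i => r (S i)))));
    [apply DefT_shift, Hu|].
  apply (Def_subst (fun z r => R (r 1) (r 0) z));
    [do 2 apply DefT_shift in Hv; exact Hv|].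
  apply (Def_ren (fun r => R (r 0) (r 1) (r 2))
    (fun j => match j with 0 => inl 2 | 1 => inl 1 | _ => inl 0 end)), HR.
Qed.

Lemma DefT_app1 f t : Fun1 f -> DefT t -> DefT (fun r => f (t r)).
Proof.
  intros Hf Ht; apply (Def_app2 (fun y x => y = f x) (fun r => r 0));
    [exact Hf|apply DefT_var|apply DefT_shift, Ht].
Qed.

Lemma DefT_app2 f t u : Fun2 f -> DefT t -> DefT u -> DefT (fun r => f (t r) (u r)).
Proof.
  intros Hf Ht Hu; apply (Def_app3 (fun z x y => z = f x y) (fun r => r 0));
    [exact Hf|apply DefT_var|apply DefT_shift, Ht|apply DefT_shift, Hu].
Qed.

(** Definite description, with value [c 0] where it fails. *)
Definition the (P : M -> Prop) : M :=
  epsilon (inhabits (c 0)) (fun x =>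
    (forall y, P y <-> y = x) \/ ~ (exists z, forall y, P y <-> y = z) /\ x = c 0).

(** Although [the] is built with [epsilon] of the metatheory, its graph has this first-order
    description, which makes definite descriptions definable. *)
Lemma the_graph P x : x = the P <->
  (forall y, P y <-> y = x) \/ ~ (exists z, forall y, P y <-> y = z) /\ x = c 0.
Proof.
  assert (H := epsilon_spec (inhabits (c 0)) (fun x =>
    (forall y, P y <-> y = x) \/
    ~ (exists z, forall y, P y <-> y = z) /\ x = c 0)).
  fold (the P) in H; cbv beta in H.
  assert (H' : (forall y, P y <-> y = the P) \/
    ~ (exists z, forall y, P y <-> y = z) /\ the P = c 0).
  { apply H; destruct (classic (exists z, forall y, P y <-> y = z)) as [[z Hz]|Hz].
    - exists z; auto.
    - exists (c 0); auto. }
  split; [intros ->; exact H'|].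
  intros [H1|[H1 ->]]; destruct H' as [H2|[H2 H3]].
  - apply H2, H1; reflexivity.
  - destruct H2; exists x; exact H1.
  - destruct H1; exists (the P); exact H2.
  - symmetry; exact H3.
Qed.

Lemma the_spec P : (exists x, P x) -> (forall x y, P x -> P y -> x = y) -> P (the P).
Proof.
  intros [x Hx] H; destruct (the_graph P (the P)) as [H1 _].
  destruct (H1 eq_refl) as [H2|[H2 _]].
  - apply H2; reflexivity.
  - destruct H2; exists x; intro y; split; [auto|intros ->; exact Hx].
Qed.

Lemma DefT_the (P : M -> (nat -> M) -> Prop) :
  Def (fun r => P (r 0) (fun i => r (S i))) -> DefT (fun r => the (fun x => P x r)).
Proof.
  intro H.
  assert (H2 : Def (fun r => P (r 0) (fun i => r (S (S i))))).
  { apply (Def_ren (fun r => P (r 0) (fun i => r (S i)))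
      (fun j => match j with 0 => inl 0 | S i => inl (S (S i)) end)), H. }
  assert (H3 : Def (fun r => P (r 0) (fun i => r (S (S (S i)))))).
  { apply (Def_ren (fun r => P (r 0) (fun i => r (S i)))
      (fun j => match j with 0 => inl 0 | S i => inl (S (S (S i))) end)), H. }
  assert (Heq : Def2 eq) by apply Def_eq_var.
  apply Def_iff with (fun r =>
    (forall y, P y (fun i => r (S i)) <-> y = r 0) \/
    ~ (exists z, forall y, P y (fun i => r (S i)) <-> y = z) /\ r 0 = c 0).
  { intro r; symmetry; apply the_graph. }
  apply Def_or; [|apply Def_and; [apply Def_not|]].
  - apply (Def_all (fun y r => P y (fun i => r (S i)) <-> y = r 0)), Def_equiv.
    + exact H2.
    + apply (Def_app2 eq); [exact Heq|apply DefT_var|apply DefT_var].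
  - apply (Def_ex (fun z r => forall y, P y (fun i => r (S i)) <-> y = z)).
    apply (Def_all (fun y r => P y (fun i => r (S (S i))) <-> y = r 0)), Def_equiv.
    + exact H3.
    + apply (Def_app2 eq); [exact Heq|apply DefT_var|apply DefT_var].
  - apply (Def_app2 eq); [exact Heq|apply DefT_var|apply DefT_const].
Qed.

Definition set_of (P : M -> Prop) : M := the (fun b => forall x, E x b <-> P x).

Definition sep (a : M) (P : M -> Prop) : M := set_of (fun x => E x a /\ P x).

Lemma DefT_set_of (P : M -> (nat -> M) -> Prop) :
  Def (fun r => P (r 0) (fun i => r (S i))) ->
  DefT (fun r => set_of (fun x => P x r)).
Proof.
  intro HP; apply (DefT_the (fun b r => forall x, E x b <-> P x r)).
  apply (Def_all (fun x r => E x (r 0) <-> P x (fun i => r (S i)))), Def_equiv.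
  - exact Def_mem_var.
  - apply (Def_ren (fun r => P (r 0) (fun i => r (S i)))
      (fun j => match j with 0 => inl 0 | S i => inl (S (S i)) end)), HP.
Qed.

Lemma DefT_sep a (P : M -> (nat -> M) -> Prop) : DefT a ->
  Def (fun r => P (r 0) (fun i => r (S i))) ->
  DefT (fun r => sep (a r) (fun x => P x r)).
Proof.
  intros Ha HP; apply (DefT_set_of (fun x r => E x (a r) /\ P x r)), Def_and; auto.
  apply (Def_app2 E (fun r => r 0)); [exact Def_mem_var|apply DefT_var|].
  apply DefT_shift, Ha.
Qed.

(* Recognition of definable predicates and functions *)
Create HintDb def.
Lemma Def2_mem : Def2 E. Proof. exact Def_mem_var. Qed.
Lemma Def2_eq : Def2 eq. Proof. exact Def_eq_var. Qed.
#[local] Hint Resolve Def2_mem Def2_eq Def_False : def.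

Ltac def_term :=
  lazymatch goal with
  | |- DefT (fun r => r ?i) => apply (DefT_var i)
  | |- DefT (fun r => the (fun x => @?P r x)) => apply (DefT_the (fun x r => P r x))
  | |- DefT (fun r => set_of (fun x => @?P r x)) =>
      apply (DefT_set_of (fun x r => P r x))
  | |- DefT (fun r => sep (@?a r) (fun x => @?P r x)) =>
      apply (DefT_sep a (fun x r => P r x))
  | |- DefT (fun r => ?f (@?t r) (@?u r)) =>
      apply (DefT_app2 f t u); [solve [eauto with def nocore]| |]
  | |- DefT (fun r => ?f (@?t r)) =>
      apply (DefT_app1 f t); [solve [eauto with def nocore]|]
  end.
(** The patterns [@?P r] expose the dependence on the environment [r]. Constants are tried before
    compound terms, since a term in which [r] does not occur is a parameter whatever its shape. *)
Ltac def_step :=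
  lazymatch goal with
  | |- Def1 _ => red
  | |- Def2 _ => red
  | |- Def3 _ => red
  | |- Fun1 _ => red
  | |- Fun2 _ => red
  | |- Def (fun r => forall x : M, @?P r x) => apply (Def_all (fun x r => P r x))
  | |- Def (fun r => exists x : M, @?P r x) => apply (Def_ex (fun x r => P r x))
  | |- Def (fun r => @?A r /\ @?B r) => apply (Def_and A B)
  | |- Def (fun r => @?A r \/ @?B r) => apply (Def_or A B)
  | |- Def (fun r => @?A r <-> @?B r) => apply (Def_equiv A B)
  | |- Def (fun r => ~ @?A r) => apply (Def_not A)
  | |- Def (fun r => @?A r -> @?B r) => apply (Def_imp A B)
  | |- Def (fun r => @?t r = @?u r) => apply (Def_app2 eq t u Def2_eq)
  | |- Def (fun r => ?R (@?t r) (@?u r) (@?v r)) =>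
      apply (Def_app3 R t u v); [solve [eauto with def nocore]| | |]
  | |- Def (fun r => ?R (@?t r) (@?u r)) =>
      apply (Def_app2 R t u); [solve [eauto with def nocore]| |]
  | |- Def (fun r => ?R (@?t r)) =>
      apply (Def_app1 R t); [solve [eauto with def nocore]|]
  | |- DefT _ => first [simple apply DefT_const | def_term]
  | |- _ => solve [eauto with def nocore]
  end.
Ltac def := cbv beta; repeat (def_step; cbv beta).

Lemma Def_Subset : Def2 Subset.
Proof. unfold Subset; def. Qed.
#[local] Hint Resolve Def_Subset : def.

Lemma Def_Empty : Def1 Empty.
Proof. unfold Empty; def. Qed.
#[local] Hint Resolve Def_Empty : def.

Lemma Def_IsPair : Def3 IsPair.
Proof. unfold IsPair; def. Qed.
#[local] Hint Resolve Def_IsPair : def.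

Lemma Def_IsSucc : Def2 IsSucc.
Proof. unfold IsSucc; def. Qed.
#[local] Hint Resolve Def_IsSucc : def.

Lemma Def_Disjoint : Def2 Disjoint.
Proof. unfold Disjoint; def. Qed.
#[local] Hint Resolve Def_Disjoint : def.

Lemma Def_Inductive_ : Def1 IsInductive.
Proof. unfold IsInductive; def. Qed.
#[local] Hint Resolve Def_Inductive_ : def.

Lemma Def_IsOpair : Def3 IsOpair.
Proof. unfold IsOpair; def. Qed.
#[local] Hint Resolve Def_IsOpair : def.

Lemma Def_Related : Def3 Related.
Proof. unfold Related; def. Qed.
#[local] Hint Resolve Def_Related : def.

Lemma Def_RelationBetween : Def3 RelationBetween.
Proof. unfold RelationBetween; def. Qed.
#[local] Hint Resolve Def_RelationBetween : def.

Lemma Def_Bijection : Def3 Bijection.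
Proof. unfold Bijection; def. Qed.
#[local] Hint Resolve Def_Bijection : def.

Lemma Def_Equipotent : Def2 Equipotent.
Proof. unfold Equipotent; def. Qed.
#[local] Hint Resolve Def_Equipotent : def.

Lemma Def_IsOmega : Def1 IsOmega.
Proof. unfold IsOmega; def. Qed.
#[local] Hint Resolve Def_IsOmega : def.

Lemma Def_Finite : Def1 Finite.
Proof. unfold Finite; def. Qed.
#[local] Hint Resolve Def_Finite : def.

Lemma Def_Clopen : Def3 Clopen.
Proof. unfold Clopen; def. Qed.
#[local] Hint Resolve Def_Clopen : def.

(** * Set theory in a model *)

Hypothesis extensionality : forall x y, (forall z, E z x <-> E z y) -> x = y.
Hypothesis pairing : forall x y, exists p, IsPair p x y.
Hypothesis union : forall x, exists u, IsUnion u x.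
Hypothesis power : forall x, exists p, IsPower p x.
Hypothesis infinity : exists w, IsInductive w.
Hypothesis separation : forall P, Def1 P ->
  forall a, exists b, forall x, E x b <-> E x a /\ P x.

(** * Pairs, unions and products *)

Lemma set_of_spec P : (exists b, forall x, E x b <-> P x) ->
  forall x, E x (set_of P) <-> P x.
Proof.
  intro H; apply (the_spec (fun b => forall x, E x b <-> P x)); [exact H|].
  intros b b' Hb Hb'; apply extensionality; intro z; rewrite Hb, Hb'; tauto.
Qed.

Lemma sep_in P a : Def1 P -> forall x, E x (sep a P) <-> E x a /\ P x.
Proof. intro H; apply set_of_spec, separation, H. Qed.

#[local] Opaque the set_of sep.

Definition upair (x y : M) : M := set_of (fun z => z = x \/ z = y).
Definition Union (x : M) : M := set_of (fun z => exists y, E y x /\ E z y).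
Definition Power (x : M) : M := set_of (fun z => Subset z x).

Lemma upair_in x y z : E z (upair x y) <-> z = x \/ z = y.
Proof. apply (set_of_spec (fun z => z = x \/ z = y)), pairing. Qed.

Lemma Union_in x z : E z (Union x) <-> exists y, E y x /\ E z y.
Proof. apply (set_of_spec (fun z => exists y, E y x /\ E z y)), union. Qed.

Lemma Power_in x z : E z (Power x) <-> Subset z x.
Proof. apply (set_of_spec (fun z => Subset z x)), power. Qed.

Definition cup (x y : M) : M := Union (upair x y).
Definition adjoin (x y : M) : M := cup x (upair y y).
Definition succ (x : M) : M := adjoin x x.
Definition cap (x y : M) : M := sep x (fun z => E z y).
Definition opair (x y : M) : M := upair (upair x x) (upair x y).
(** Any set could be cut down here; [c 0] is an element of the model that is at hand. *)
Definition empty : M := sep (c 0) (fun _ => False).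

Lemma cup_in x y z : E z (cup x y) <-> E z x \/ E z y.
Proof.
  unfold cup; rewrite Union_in; split.
  - intros [w [Hw Hz]]; apply upair_in in Hw; destruct Hw as [->| ->]; auto.
  - intros [H|H]; [exists x|exists y]; rewrite upair_in; auto.
Qed.

Lemma adjoin_in x y z : E z (adjoin x y) <-> E z x \/ z = y.
Proof. unfold adjoin; rewrite cup_in, upair_in; tauto. Qed.

Lemma succ_in x z : E z (succ x) <-> E z x \/ z = x.
Proof. apply adjoin_in. Qed.

Lemma cap_in x y z : E z (cap x y) <-> E z x /\ E z y.
Proof. apply (sep_in (fun z => E z y)); def. Qed.

Lemma empty_in z : ~ E z empty.
Proof. unfold empty; rewrite sep_in by def; tauto. Qed.

Lemma eq_empty x : Empty x <-> x = empty.
Proof.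
  split.
  - intro H; apply extensionality; intro z; generalize (empty_in z) (H z); tauto.
  - intros -> z; apply empty_in.
Qed.

Lemma not_empty x : ~ Empty x <-> exists z, E z x.
Proof.
  split.
  - intro H; apply NNPP; intro H'; apply H; intros z Hz; eauto.
  - intros [z Hz] H; exact (H z Hz).
Qed.

Lemma Fun2_upair : Fun2 upair. Proof. unfold upair; def. Qed.
Lemma Fun1_Union : Fun1 Union. Proof. unfold Union; def. Qed.
Lemma Fun1_Power : Fun1 Power. Proof. unfold Power; def. Qed.
Lemma Fun2_cap : Fun2 cap. Proof. unfold cap; def. Qed.
#[local] Hint Resolve Fun2_upair Fun1_Union Fun1_Power Fun2_cap : def.
Lemma Fun2_cup : Fun2 cup. Proof. unfold cup; def. Qed.
#[local] Hint Resolve Fun2_cup : def.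
Lemma Fun2_adjoin : Fun2 adjoin. Proof. unfold adjoin; def. Qed.
#[local] Hint Resolve Fun2_adjoin : def.
Lemma Fun1_succ : Fun1 succ. Proof. unfold succ; def. Qed.
Lemma Fun2_opair : Fun2 opair. Proof. unfold opair; def. Qed.
#[local] Hint Resolve Fun1_succ Fun2_opair : def.

Lemma eq_upair p x y : IsPair p x y <-> p = upair x y.
Proof.
  split.
  - intro H; apply extensionality; intro z; rewrite upair_in; apply H.
  - intros -> z; apply upair_in.
Qed.

Lemma eq_opair p x y : IsOpair p x y <-> p = opair x y.
Proof.
  split.
  - intros [s [t [Hs [Ht Hp]]]]; apply eq_upair in Hs, Ht, Hp; subst; reflexivity.
  - intros ->; exists (upair x x), (upair x y); rewrite !eq_upair; auto.
Qed.

Lemma eq_succ s x : IsSucc s x <-> s = succ x.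
Proof.
  split.
  - intro H; apply extensionality; intro z; rewrite succ_in; apply H.
  - intros -> z; apply succ_in.
Qed.

Lemma upair_inj x y x' y' : upair x y = upair x' y' ->
  x = x' /\ y = y' \/ x = y' /\ y = x'.
Proof.
  intro H.
  assert (H1 : E x (upair x' y')) by (rewrite <- H, upair_in; auto).
  assert (H2 : E y (upair x' y')) by (rewrite <- H, upair_in; auto).
  assert (H3 : E x' (upair x y)) by (rewrite H, upair_in; auto).
  assert (H4 : E y' (upair x y)) by (rewrite H, upair_in; auto).
  rewrite upair_in in *; intuition congruence.
Qed.

Lemma opair_inj x y x' y' : opair x y = opair x' y' -> x = x' /\ y = y'.
Proof.
  intro H; apply upair_inj in H; destruct H as [[H1 H2]|[H1 H2]];
    apply upair_inj in H1, H2; intuition congruence.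
Qed.

Lemma Subset_antisym x y : Subset x y -> Subset y x -> x = y.
Proof. intros H H'; apply extensionality; intro z; split; [apply H|apply H']. Qed.

Definition prod (X Y : M) : M :=
  sep (Power (Power (cup X Y)))
    (fun p => exists x, E x X /\ exists y, E y Y /\ p = opair x y).

Lemma prod_in X Y p :
  E p (prod X Y) <-> exists x, E x X /\ exists y, E y Y /\ p = opair x y.
Proof.
  unfold prod; rewrite sep_in by def; split; [tauto|].
  intros [x [Hx [y [Hy ->]]]]; split; [|eauto 6].
  apply Power_in; intros s Hs; apply upair_in in Hs; apply Power_in.
  intros z Hz; apply cup_in; destruct Hs as [->| ->]; apply upair_in in Hz;
    destruct Hz as [->| ->]; auto.
Qed.

#[local] Opaque upair Union Power cap cup adjoin succ opair empty.

Lemma opair_prod X Y x y : E (opair x y) (prod X Y) <-> E x X /\ E y Y.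
Proof.
  rewrite prod_in; split; [|intros [Hx Hy]; eauto 6].
  intros [x' [Hx [y' [Hy H]]]]; apply opair_inj in H; destruct H; subst; auto.
Qed.

(** * Relations and equipotence *)

Lemma Related_opair f x y : Related f x y <-> E (opair x y) f.
Proof.
  split.
  - intros [p [Hp H]]; apply eq_opair in H; subst; exact Hp.
  - intro H; exists (opair x y); rewrite eq_opair; auto.
Qed.

(** Separation inside [prod X Y] turns the definable relation [R] into a set of the model, so
    bijections can be specified by formulas. *)
Lemma mk_equip R X Y : Def2 R ->
  (forall x, E x X -> exists y, E y Y /\ R x y) ->
  (forall y, E y Y -> exists x, E x X /\ R x y) ->
  (forall x y y', E x X -> E y Y -> E y' Y -> R x y -> R x y' -> y = y') ->
  (forall x x' y, E x X -> E x' X -> E y Y -> R x y -> R x' y -> x = x') ->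
  Equipotent X Y.
Proof.
  intros HR H1 H2 H3 H4.
  exists (sep (prod X Y) (fun p => exists x y, p = opair x y /\ R x y)).
  assert (HG : forall x y,
    Related (sep (prod X Y) (fun p => exists x y, p = opair x y /\ R x y)) x y
    <-> (E x X /\ E y Y) /\ R x y).
  { intros x y; rewrite Related_opair, sep_in, opair_prod by def; split.
    - intros [Hxy [x' [y' [H HR']]]]; apply opair_inj in H; destruct H; subst; auto.
    - intros [Hxy HR']; eauto. }
  repeat split.
  - intros p Hp; rewrite sep_in in Hp by def; destruct Hp as [Hp _].
    apply prod_in in Hp; destruct Hp as [x [Hx [y [Hy Hp]]]].
    exists x; split; auto; exists y; rewrite eq_opair; auto.
  - intros x Hx; destruct (H1 x Hx) as [y [Hy Hxy]]; exists y; intro y'.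
    rewrite HG; split; [intros [_ [[_ Hy'] H]]; eauto|intros ->; auto].
  - intros y Hy; destruct (H2 y Hy) as [x [Hx Hxy]]; exists x; intro x'.
    rewrite HG; split; [intros [_ [[Hx' _] H]]; eauto|intros ->; auto].
Qed.

(** The passage opposite to [mk_equip]: a bijection that is a set becomes two mutually inverse
    definable functions, which compose without coding. *)
Lemma equip_fun X Y : Equipotent X Y -> exists f g, Fun1 f /\ Fun1 g /\
  (forall x, E x X -> E (f x) Y /\ g (f x) = x) /\
  (forall y, E y Y -> E (g y) X /\ f (g y) = y).
Proof.
  intros [h [_ [H1 H2]]].
  set (f := fun x => the (fun y => E y Y /\ Related h x y)).
  set (g := fun y => the (fun x => E x X /\ Related h x y)).
  exists f, g.
  assert (Hf : forall x, E x X -> E (f x) Y /\ Related h x (f x)).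
  { intros x Hx; destruct (H1 x Hx) as [z Hz].
    apply (the_spec (fun y => E y Y /\ Related h x y)).
    - exists z; apply Hz; reflexivity.
    - intros y y' Hy Hy'; apply Hz in Hy, Hy'; congruence. }
  assert (Hg : forall y, E y Y -> E (g y) X /\ Related h (g y) y).
  { intros y Hy; destruct (H2 y Hy) as [z Hz].
    apply (the_spec (fun x => E x X /\ Related h x y)).
    - exists z; apply Hz; reflexivity.
    - intros x x' Hx Hx'; apply Hz in Hx, Hx'; congruence. }
  split; [unfold f; def|split; [unfold g; def|split]].
  - intros x Hx; destruct (Hf x Hx) as [Hy Hr]; split; auto.
    destruct (Hg _ Hy) as [Hx' Hr'], (H2 _ Hy) as [z Hz].
    transitivity z; [|symmetry]; apply Hz; auto.
  - intros y Hy; destruct (Hg y Hy) as [Hx Hr]; split; auto.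
    destruct (Hf _ Hx) as [Hy' Hr'], (H1 _ Hx) as [z Hz].
    transitivity z; [|symmetry]; apply Hz; auto.
Qed.

Lemma equip_sym X Y : Equipotent X Y -> Equipotent Y X.
Proof.
  intro H; destruct (equip_fun X Y H) as [f [g [Hf [Hg [H1 H2]]]]].
  apply (mk_equip (fun y x => x = g y)); [def|..].
  - intros y Hy; exists (g y); split; auto; apply H2, Hy.
  - intros x Hx; exists (f x); split; [|symmetry]; apply H1, Hx.
  - intros; congruence.
  - intros y y' x Hy Hy' _ -> H'; destruct (H2 y Hy), (H2 y' Hy'); congruence.
Qed.

Lemma equip_trans X Y Z : Equipotent X Y -> Equipotent Y Z -> Equipotent X Z.
Proof.
  intros H H'; destruct (equip_fun X Y H) as [f [g [Hf [Hg [H1 H2]]]]].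
  destruct (equip_fun Y Z H') as [f' [g' [Hf' [Hg' [H1' H2']]]]].
  apply (mk_equip (fun x z => z = f' (f x))); [def|..].
  - intros x Hx; exists (f' (f x)); split; auto; apply H1', H1, Hx.
  - intros z Hz; destruct (H2' z Hz) as [Hy Hz'], (H2 _ Hy) as [Hx Hy'].
    exists (g (g' z)); split; congruence.
  - intros; congruence.
  - intros x x' z Hx Hx' _ -> H''; destruct (H1 x Hx) as [Hy Hx1],
      (H1 x' Hx') as [Hy' Hx1'], (H1' _ Hy), (H1' _ Hy'); congruence.
Qed.

(** * The natural numbers of the model *)

Definition omega : M := the IsOmega.

Lemma omega_ok : IsOmega omega.
Proof.
  apply (the_spec IsOmega).
  - destruct infinity as [w Hw].
    exists (sep w (fun x => forall v, IsInductive v -> E x v)); split; [split|].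
    + destruct Hw as [[x [Hx He]] _]; exists x; rewrite sep_in by def.
      repeat split; auto.
      intros v [[y [Hy He']] _]; apply eq_empty in He, He'; congruence.
    + intros x Hx; rewrite sep_in in Hx by def; destruct Hx as [Hx Hv].
      destruct Hw as [_ Hw]; destruct (Hw x Hx) as [s [Hs Hss]].
      exists s; rewrite sep_in by def; split; [split|]; auto.
      intros v Hi; assert (Hxv := Hv v Hi); destruct Hi as [_ Hi].
      destruct (Hi x Hxv) as [s' [Hs' Hss']]; apply eq_succ in Hss, Hss'; congruence.
    + intros v Hv x Hx; rewrite sep_in in Hx by def; apply Hx, Hv.
  - intros w w' [H1 H2] [H1' H2']; apply Subset_antisym; auto.
Qed.

Lemma eq_omega w : IsOmega w <-> w = omega.
Proof.
  split; [|intros ->; apply omega_ok].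
  intros [H1 H2]; destruct omega_ok as [H1' H2']; apply Subset_antisym; auto.
Qed.

Lemma zero_omega : E empty omega.
Proof. destruct omega_ok as [[[x [Hx He]] _] _]; apply eq_empty in He; congruence. Qed.

Lemma succ_omega n : E n omega -> E (succ n) omega.
Proof.
  intro Hn; destruct omega_ok as [[_ H] _]; destruct (H n Hn) as [s [Hs He]].
  apply eq_succ in He; congruence.
Qed.

(** Definability of [P] makes the numbers satisfying it an inductive set of the model; for an
    arbitrary predicate this would fail at nonstandard numbers. *)
Lemma omega_ind P : Def1 P -> P empty ->
  (forall n, E n omega -> P n -> P (succ n)) -> forall n, E n omega -> P n.
Proof.
  intros HP H0 HS n Hn.
  assert (H : Subset omega (sep omega P)).
  { apply omega_ok; split.
    - exists empty; rewrite sep_in, eq_empty by exact HP.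
      auto using zero_omega.
    - intros x Hx; rewrite sep_in in Hx by exact HP; exists (succ x).
      rewrite sep_in, eq_succ by exact HP; destruct Hx; auto using succ_omega. }
  specialize (H n Hn); rewrite sep_in in H by exact HP; apply H.
Qed.

Lemma omega_trans n k : E n omega -> E k n -> E k omega.
Proof.
  intros Hn; revert n Hn k.
  apply (omega_ind (fun n => forall k, E k n -> E k omega)); [def| |].
  - intros k Hk; destruct (empty_in k Hk).
  - intros n Hn IH k Hk; apply succ_in in Hk; destruct Hk as [Hk| ->]; auto.
Qed.

Lemma nat_trans n k j : E n omega -> E k n -> E j k -> E j n.
Proof.
  intros Hn; revert n Hn k j.
  apply (omega_ind (fun n => forall k j, E k n -> E j k -> E j n)); [def| |].
  - intros k j Hk; destruct (empty_in k Hk).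
  - intros n Hn IH k j Hk Hj; apply succ_in in Hk; apply succ_in; left.
    destruct Hk as [Hk| ->]; eauto.
Qed.

Lemma nat_irrefl n : E n omega -> ~ E n n.
Proof.
  revert n; apply (omega_ind (fun n => ~ E n n)); [def|apply empty_in|].
  intros n Hn IH H; apply IH; apply succ_in in H.
  destruct H as [H|H].
  - apply (nat_trans n (succ n)); auto; apply succ_in; auto.
  - rewrite <- H at 2; apply succ_in; auto.
Qed.

Lemma succ_mono n k : E n omega -> E k n -> E (succ k) (succ n).
Proof.
  intros Hn; revert n Hn k.
  apply (omega_ind (fun n => forall k, E k n -> E (succ k) (succ n))); [def| |].
  - intros k Hk; destruct (empty_in k Hk).
  - intros n Hn IH k Hk; apply succ_in in Hk; apply succ_in.
    destruct Hk as [Hk| ->]; auto.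
Qed.

Lemma zero_or_pos n : E n omega -> n = empty \/ E empty n.
Proof.
  revert n; apply (omega_ind (fun n => n = empty \/ E empty n)); [def|auto|].
  intros n Hn [->|IH]; right; apply succ_in; auto.
Qed.

Lemma nat_tricho n m : E n omega -> E m omega -> E n m \/ n = m \/ E m n.
Proof.
  intros Hn; revert n Hn m.
  apply (omega_ind (fun n => forall m, E m omega -> E n m \/ n = m \/ E m n)); [def| |].
  - intros m Hm; destruct (zero_or_pos m Hm); auto.
  - intros n Hn IH m Hm; destruct (IH m Hm) as [H|[->|H]].
    + apply succ_mono in H; auto; apply succ_in in H; tauto.
    + right; right; apply succ_in; auto.
    + right; right; apply succ_in; auto.
Qed.

Lemma nat_least P : Def1 P -> (exists n, E n omega /\ P n) ->
  exists n, E n omega /\ P n /\ forall k, E k n -> ~ P k.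
Proof.
  intros HP [n [Hn Hp]]; apply NNPP; intro H.
  assert (H' : forall n, E n omega -> forall k, E k n -> ~ P k).
  { apply (omega_ind (fun n => forall k, E k n -> ~ P k)); [def| |].
    - intros k Hk; destruct (empty_in k Hk).
    - intros m Hm IH k Hk; apply succ_in in Hk; destruct Hk as [Hk| ->]; auto.
      intro Hpm; apply H; exists m; auto. }
  apply (H' (succ n) (succ_omega n Hn) n); auto; apply succ_in; auto.
Qed.

Lemma nat_upper n m : E n omega -> E m omega ->
  exists k, E k omega /\ (n = k \/ E n k) /\ (m = k \/ E m k).
Proof.
  intros Hn Hm; destruct (nat_tricho n m Hn Hm) as [H|[H|H]];
    [exists m|exists m|exists n]; auto.
Qed.

(** * Finite sets *)

Lemma eq_Finite X : Finite X <-> exists n, E n omega /\ Equipotent X n.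
Proof.
  split.
  - intros [w [Hw H]]; apply eq_omega in Hw; subst; exact H.
  - intro H; exists omega; split; [apply omega_ok|exact H].
Qed.

Lemma finite_equip X Y : Equipotent X Y -> Finite Y -> Finite X.
Proof.
  intros H H'; apply eq_Finite in H'; apply eq_Finite.
  destruct H' as [n [Hn H']]; exists n; split; auto.
  apply equip_trans with Y; auto.
Qed.

Lemma equip_refl X : Equipotent X X.
Proof. apply (mk_equip (fun x y => x = y)); [def|..]; intros; eauto; congruence. Qed.

Lemma finite_empty : Finite empty.
Proof.
  apply eq_Finite; exists empty; split; [apply zero_omega|apply equip_refl].
Qed.

Lemma equip_adjoin X Y u v : ~ E u X -> ~ E v Y -> Equipotent X Y ->
  Equipotent (adjoin X u) (adjoin Y v).
Proof.
  intros Hu Hv H; destruct (equip_fun X Y H) as [f [g [Hf [Hg [H1 H2]]]]].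
  apply (mk_equip (fun x y => E x X /\ y = f x \/ x = u /\ y = v)); [def|..].
  - intros x Hx; apply adjoin_in in Hx; destruct Hx as [Hx| ->].
    + exists (f x); rewrite adjoin_in; destruct (H1 x Hx); auto.
    + exists v; rewrite adjoin_in; auto.
  - intros y Hy; apply adjoin_in in Hy; destruct Hy as [Hy| ->].
    + exists (g y); rewrite adjoin_in; destruct (H2 y Hy); auto.
    + exists u; rewrite adjoin_in; auto.
  - intros x y y' _ _ _ [[Hx ->]|[-> ->]] [[Hx' ->]|[Hx' ->]]; congruence.
  - intros x x' y _ _ _ [[Hx ->]|[-> ->]] [[Hx' H']|[-> H']]; auto.
    + destruct (H1 x Hx), (H1 x' Hx'); congruence.
    + destruct Hv; rewrite <- H'; apply H1, Hx.
    + destruct Hv; rewrite H'; apply H1, Hx'.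
Qed.

Lemma finite_adjoin X u : Finite X -> Finite (adjoin X u).
Proof.
  intro H; destruct (classic (E u X)) as [Hu|Hu].
  - replace (adjoin X u) with X; auto; apply extensionality; intro z.
    rewrite adjoin_in; split; [auto|intros [Hz| ->]; auto].
  - apply eq_Finite in H; apply eq_Finite; destruct H as [n [Hn H]].
    exists (succ n); split; [apply succ_omega, Hn|].
    change (succ n) with (adjoin n n).
    apply equip_adjoin; auto; apply nat_irrefl, Hn.
Qed.

(** Induction on the size: a set equipotent with [succ n] is one equipotent with [n] to which the
    element matched with [n] is adjoined. *)
Lemma finite_ind P : Def1 P -> P empty ->
  (forall S u, P S -> P (adjoin S u)) -> forall S, Finite S -> P S.
Proof.
  intros HP H0 HS S H; apply eq_Finite in H; destruct H as [n [Hn H]].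
  revert n Hn S H.
  apply (omega_ind (fun n => forall S, Equipotent S n -> P S)); [def| |].
  - intros S H; destruct (equip_fun _ _ H) as [f [g [_ [_ [H1 _]]]]].
    replace S with empty; auto; symmetry; apply eq_empty; intros x Hx.
    apply (empty_in (f x)), H1, Hx.
  - intros n Hn IH S H; destruct (equip_fun _ _ H) as [f [g [Hf [Hg [H1 H2]]]]].
    assert (Hnn : E n (succ n)) by (apply succ_in; auto).
    assert (HS' : S = adjoin (sep S (fun x => x <> g n)) (g n)).
    { apply extensionality; intro z; rewrite adjoin_in, sep_in by def.
      split; [intro Hz; destruct (classic (z = g n)); auto|].
      intros [[Hz _]| ->]; auto; apply H2, Hnn. }
    rewrite HS'; apply HS, IH.
    apply (mk_equip (fun x y => y = f x)); [def|..].
    + intros x Hx; rewrite sep_in in Hx by def; destruct Hx as [Hx Hxn].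
      exists (f x); split; auto; destruct (H1 x Hx) as [Hfx Hgx].
      apply succ_in in Hfx; destruct Hfx as [Hfx|Hfx]; auto; congruence.
    + intros y Hy; exists (g y).
      assert (Hy' : E y (succ n)) by (apply succ_in; auto).
      destruct (H2 y Hy') as [Hgy Hfy]; rewrite sep_in by def.
      repeat split; auto; intro Heq; apply (nat_irrefl n Hn).
      destruct (H2 n Hnn); congruence.
    + intros; congruence.
    + intros x x' y Hx Hx' _ -> Heq; rewrite sep_in in Hx, Hx' by def.
      destruct Hx as [Hx _], Hx' as [Hx' _], (H1 x Hx), (H1 x' Hx'); congruence.
Qed.

Lemma finite_sub S R : Finite S -> Subset R S -> Finite R.
Proof.
  intros HS; revert S HS R.
  apply (finite_ind (fun S => forall R, Subset R S -> Finite R)); [def| |].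
  - intros R H; replace R with empty; [apply finite_empty|].
    symmetry; apply eq_empty; intros x Hx; apply (empty_in x), H, Hx.
  - intros S u IH R H.
    assert (H1 : Finite (sep R (fun x => x <> u))).
    { apply IH; intros x Hx; rewrite sep_in in Hx by def; destruct Hx as [Hx Hu].
      specialize (H x Hx); apply adjoin_in in H; tauto. }
    destruct (classic (E u R)) as [Hu|Hu].
    + replace R with (adjoin (sep R (fun x => x <> u)) u);
        [apply finite_adjoin, H1|].
      apply extensionality; intro z; rewrite adjoin_in, sep_in by def.
      split; [intros [[Hz _]| ->]; auto|].
      intro Hz; destruct (classic (z = u)); auto.
    + replace R with (sep R (fun x => x <> u)); auto.
      apply extensionality; intro z; rewrite sep_in by def.
      split; [tauto|]; intro Hz; split; auto; congruence.
Qed.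

Lemma finite_cup S R : Finite S -> Finite R -> Finite (cup S R).
Proof.
  intros HS HR; revert R HR.
  apply (finite_ind (fun R => Finite (cup S R))); [def| |].
  - replace (cup S empty) with S; auto; apply extensionality; intro z.
    rewrite cup_in; generalize (empty_in z); tauto.
  - intros R u IH; replace (cup S (adjoin R u)) with (adjoin (cup S R) u);
      [apply finite_adjoin, IH|].
    apply extensionality; intro z; rewrite adjoin_in, !cup_in, adjoin_in; tauto.
Qed.

Lemma finite_surj f X Y : Fun1 f -> Finite X ->
  (forall y, E y Y -> exists x, E x X /\ y = f x) -> Finite Y.
Proof.
  intros Hf HX; revert X HX Y.
  apply (finite_ind (fun X => forall Y,
    (forall y, E y Y -> exists x, E x X /\ y = f x) -> Finite Y)); [def| |].
  - intros Y H; apply finite_sub with empty; [apply finite_empty|].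
    intros y Hy; destruct (H y Hy) as [x [Hx _]]; destruct (empty_in x Hx).
  - intros X u IH Y H.
    apply finite_sub with
      (adjoin (sep Y (fun y => exists x, E x X /\ y = f x)) (f u)).
    + apply finite_adjoin, IH; intros y Hy; rewrite sep_in in Hy by def; apply Hy.
    + intros y Hy; rewrite adjoin_in, sep_in by def.
      destruct (H y Hy) as [x [Hx ->]]; apply adjoin_in in Hx.
      destruct Hx as [Hx| ->]; eauto.
Qed.

Lemma finite_inj f X Y : Fun1 f -> Finite Y ->
  (forall x, E x X -> E (f x) Y) ->
  (forall x x', E x X -> E x' X -> f x = f x' -> x = x') -> Finite X.
Proof.
  intros Hf HY H1 H2.
  apply finite_equip with (sep Y (fun y => exists x, E x X /\ y = f x)).
  - apply (mk_equip (fun x y => y = f x)); [def|..].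
    + intros x Hx; exists (f x); rewrite sep_in by def; eauto 6.
    + intros y Hy; rewrite sep_in in Hy by def; apply Hy.
    + intros; congruence.
    + intros x x' y Hx Hx' _ -> H; auto.
  - apply finite_sub with Y; auto; intros y Hy; rewrite sep_in in Hy by def; apply Hy.
Qed.

Lemma finite_Power S : Finite S -> Finite (Power S).
Proof.
  revert S; apply (finite_ind (fun S => Finite (Power S))); [def| |].
  - apply finite_sub with (adjoin empty empty); [apply finite_adjoin, finite_empty|].
    intros x Hx; apply Power_in in Hx; apply adjoin_in; right; apply eq_empty.
    intros z Hz; apply (empty_in z), Hx, Hz.
  - intros S u IH.
    set (Y := sep (Power (adjoin S u))
      (fun Z => exists R, E R (Power S) /\ Z = adjoin R u)).
    apply finite_sub with (cup (Power S) Y).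
    + apply finite_cup; auto.
      apply (finite_surj (fun R => adjoin R u) (Power S)); auto; [def|].
      intros y Hy; unfold Y in Hy; rewrite sep_in in Hy by def; apply Hy.
    + intros Z HZ; assert (HZ' := HZ); apply Power_in in HZ.
      apply cup_in; unfold Y; rewrite sep_in by def.
      destruct (classic (E u Z)) as [Hu|Hu].
      * right; split; auto; exists (sep Z (fun x => x <> u)); split.
        -- apply Power_in; intros z Hz; rewrite sep_in in Hz by def.
           destruct Hz as [Hz Hn]; specialize (HZ z Hz); apply adjoin_in in HZ; tauto.
        -- apply extensionality; intro z; rewrite adjoin_in, sep_in by def.
           split; [|intros [[Hz _]| ->]; auto].
           intro Hz; destruct (classic (z = u)); auto.
      * left; apply Power_in; intros z Hz; specialize (HZ z Hz).
        apply adjoin_in in HZ; destruct HZ as [HZ| ->]; tauto.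
Qed.

(** By induction every finite subset of [omega] is included in some number n; for [omega] itself
    this would give n ∈ n. *)
Lemma omega_infinite : ~ Finite omega.
Proof.
  intro H.
  assert (H' : forall S, Finite S -> Subset S omega ->
    exists n, E n omega /\ Subset S n).
  { apply (finite_ind (fun S => Subset S omega ->
      exists n, E n omega /\ Subset S n)); [def| |].
    - intros _; exists empty; split; [apply zero_omega|intros x Hx; exact Hx].
    - intros S u IH HS; destruct IH as [n [Hn HSn]].
      { intros x Hx; apply HS, adjoin_in; auto. }
      assert (Hu : E u omega) by (apply HS, adjoin_in; auto).
      destruct (nat_upper n (succ u)) as [k [Hk [H1 H2]]]; auto using succ_omega.
      exists k; split; auto; intros x Hx; apply adjoin_in in Hx.
      destruct Hx as [Hx| ->].
      + destruct H1 as [->|H1]; auto; apply (nat_trans k n); auto.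
      + assert (Hus : E u (succ u)) by (apply succ_in; auto).
        destruct H2 as [<-|H2]; auto; apply (nat_trans k (succ u)); auto. }
  destruct (H' omega H) as [n [Hn Hs]]; [intros x Hx; exact Hx|].
  apply (nat_irrefl n Hn), Hs, Hn.
Qed.

(** * Definable sequences *)

Lemma inj_infinite f X : Fun1 f -> (forall n, E n omega -> E (f n) X) ->
  (forall n k, E n omega -> E k omega -> f n = f k -> n = k) -> ~ Finite X.
Proof. intros Hf H1 H2 HX; apply omega_infinite, (finite_inj f omega X); auto. Qed.

Lemma denumerable_range f X : Fun1 f -> (forall n, E n omega -> E (f n) X) ->
  (forall n k, E n omega -> E k omega -> f n = f k -> n = k) ->
  (forall x, E x X -> exists n, E n omega /\ x = f n) -> Denumerable X.
Proof.
  intros Hf H1 H2 H3; exists omega; split; [apply omega_ok|].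
  apply equip_sym, (mk_equip (fun n x => x = f n)); [def|..]; auto.
  - intros n Hn; exists (f n); auto.
  - intros; congruence.
  - intros n n' x Hn Hn' _ -> H; auto.
Qed.

Lemma denumerable_fun X : Denumerable X -> exists f, Fun1 f /\
  (forall n, E n omega -> E (f n) X) /\
  (forall n k, E n omega -> E k omega -> f n = f k -> n = k).
Proof.
  intros [w [Hw H]]; apply eq_omega in Hw; subst w.
  destruct (equip_fun _ _ H) as [f [g [Hf [Hg [H1 H2]]]]]; exists g.
  repeat split; auto; [intros n Hn; apply H2, Hn|].
  intros n k Hn Hk Heq; destruct (H2 n Hn), (H2 k Hk); congruence.
Qed.

(** The recursively defined function is the intersection of all sets closed
    under the recursion step. *)
Lemma recursion Y a h (I : M -> M -> Prop) : Fun2 h -> Def2 I ->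
  (forall n y, E n omega -> I n y -> E y Y) -> I empty a ->
  (forall n y, E n omega -> I n y -> I (succ n) (h n y)) ->
  exists v, Fun1 v /\ v empty = a /\
    (forall n, E n omega -> v (succ n) = h n (v n)) /\
    (forall n, E n omega -> I n (v n)).
Proof.
  intros Hh HI HY H0 HS.
  (* Closure is demanded only at values satisfying the invariant [I], since elsewhere nothing is
     known of [h]; through [I] the values also stay in [Y], so that the graph is a set. *)
  set (closed := fun Z => E (opair empty a) Z /\
    forall n y, E n omega -> I n y -> E (opair n y) Z ->
      E (opair (succ n) (h n y)) Z).
  assert (Hclosed : Def1 closed) by (unfold closed; def).
  set (R := fun n y => I n y /\ forall Z, closed Z -> E (opair n y) Z).
  assert (HR : Def2 R) by (unfold R; def).
  assert (R0 : R empty a) by (split; [exact H0|intros Z [HZ _]; exact HZ]).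
  assert (RS : forall n y, E n omega -> R n y -> R (succ n) (h n y)).
  { intros n y Hn [Hy HZ]; split; auto.
    intros Z Hc; apply Hc; auto. }
  set (G := sep (prod omega Y)
    (fun p => exists n y, p = opair n y /\ R n y)).
  assert (HG : forall n y, E (opair n y) G <-> E n omega /\ R n y).
  { intros n y; unfold G; rewrite sep_in, opair_prod by def; split.
    - intros [[Hn Hy] [n' [y' [Heq H]]]]; apply opair_inj in Heq.
      destruct Heq; subst; auto.
    - intros [Hn H]; split; [split; auto; apply (HY n); auto; apply H|eauto]. }
  assert (R1 : forall n y, E n omega -> R n y ->
    (n = empty /\ y = a \/ exists k z, E k omega /\ R k z /\ n = succ k /\ y = h k z)).
  { intros n y Hn H; apply NNPP; intro H'.
    (* Minimality: a pair that is neither the initial one nor a successor of another could be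
       removed without destroying closure. *)
    assert (Hc : closed (sep G (fun p => p <> opair n y))).
    { split.
      - rewrite sep_in, HG by def; repeat split; auto using zero_omega; try apply R0.
        intro Heq; apply opair_inj in Heq; apply H'; left; intuition congruence.
      - intros k z Hk _ Hkz; rewrite sep_in, HG in Hkz by def.
        destruct Hkz as [[_ Hkz] _]; rewrite sep_in, HG by def.
        split; [split; auto using succ_omega|].
        intro Heq; apply opair_inj in Heq; apply H'; right; exists k, z.
        intuition congruence. }
    destruct H as [_ H]; specialize (H _ Hc); rewrite sep_in in H by def; tauto. }
  assert (succ_inj : forall n k, E n omega -> E k omega -> succ n = succ k -> n = k).
  { intros n k Hn Hk Heq; destruct (nat_tricho n k Hn Hk) as [H|[H|H]]; auto.
    - apply succ_mono in H; auto; rewrite Heq in H.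
      destruct (nat_irrefl (succ k)); auto using succ_omega.
    - apply succ_mono in H; auto; rewrite Heq in H.
      destruct (nat_irrefl (succ k)); auto using succ_omega. }
  assert (succ_empty : forall n, succ n <> empty).
  { intros n H; apply (empty_in n); rewrite <- H; apply succ_in; auto. }
  assert (Huniq : forall n, E n omega -> forall y y', R n y -> R n y' -> y = y').
  { apply (omega_ind (fun n => forall y y', R n y -> R n y' -> y = y')); [def| |].
    - intros y y' H H'; apply R1 in H, H'; auto using zero_omega.
      destruct H as [[_ ->]|[k [z [_ [_ [H _]]]]]]; [|destruct (succ_empty k); auto].
      destruct H' as [[_ ->]|[k [z [_ [_ [H _]]]]]]; [|destruct (succ_empty k)]; auto.
    - intros n Hn IH y y' H H'; apply R1 in H, H'; auto using succ_omega.
      destruct H as [[H _]|[k [z [Hk [Hz [H ->]]]]]]; [destruct (succ_empty n); auto|].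
      destruct H' as [[H' _]|[k' [z' [Hk' [Hz' [H' ->]]]]]];
        [destruct (succ_empty n); auto|].
      apply succ_inj in H, H'; auto; subst; f_equal; auto. }
  assert (Hex : forall n, E n omega -> exists y, R n y).
  { apply (omega_ind (fun n => exists y, R n y)); [def|eauto|].
    intros n Hn [y Hy]; eauto. }
  set (v := fun n => the (fun y => R n y)).
  assert (Hv : forall n, E n omega -> R n (v n)).
  { intros n Hn; apply (the_spec (fun y => R n y)); auto; apply Huniq, Hn. }
  exists v; repeat split.
  - unfold v; def.
  - apply (Huniq empty); auto using zero_omega.
  - intros n Hn; apply (Huniq (succ n)); auto using succ_omega.
  - intros n Hn; apply Hv, Hn.
Qed.

(** * Cellular families *)

Lemma IQDI_sequence Q : HoldsIQDI -> ~ Finite Q -> exists F, Fun1 F /\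
  (forall n, E n omega -> Finite (F n) /\ Subset (F n) Q) /\
  (forall n k, E n omega -> E k omega -> F n = F k -> n = k).
Proof.
  intros HI HQ.
  destruct (HI Q (sep (Power Q) Finite)) as [D [HD Hden]].
  { split; [exact HQ|]; intro s; rewrite sep_in, Power_in by def; tauto. }
  destruct (denumerable_fun D Hden) as [F [HF [H1 H2]]]; exists F.
  repeat split; auto.
  - specialize (HD _ (H1 n H)); rewrite sep_in in HD by def; apply HD.
  - specialize (HD _ (H1 n H)); rewrite sep_in, Power_in in HD by def; apply HD.
Qed.

Lemma decreasing_le O : Fun1 O ->
  (forall n, E n omega -> Subset (O (succ n)) (O n)) ->
  forall n k, E n omega -> E k omega -> n = k \/ E n k -> Subset (O k) (O n).
Proof.
  intros HO Hdec n k Hn Hk [->|H]; [intros x Hx; exact Hx|].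
  revert k Hk H; apply (omega_ind (fun k => E n k -> Subset (O k) (O n))); [def| |].
  - intro H; destruct (empty_in n H).
  - intros k Hk IH H x Hx; apply Hdec in Hx; auto.
    apply succ_in in H; destruct H as [H| ->]; auto; apply IH; auto.
Qed.

(** The next value is the first term properly contained in the present one, so the least index does
    the work of choice. The recursion runs on values, and [n = m \/ E n m] records that [v n] is
    reached at or past position n, whence [v n] is included in [O n]. *)
Lemma strict_subsequence O : Fun1 O ->
  (forall n, E n omega -> Subset (O (succ n)) (O n)) ->
  (forall n, E n omega -> exists m, E m omega /\ E n m /\ O m <> O n) ->
  exists v, Fun1 v /\
    (forall n, E n omega ->
       exists m, E m omega /\ (n = m \/ E n m) /\ v n = O m) /\
    (forall n, E n omega -> Subset (v (succ n)) (v n)) /\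
    (forall n k, E n omega -> E k omega -> E n k -> Subset (v k) (v (succ n))) /\
    (forall n, E n omega -> v (succ n) <> v n).
Proof.
  intros HO Hdec Hnc.
  assert (Hle := decreasing_le O HO Hdec).
  set (h := fun n y : M => the (fun z => (Subset z y /\ z <> y) /\
    exists m, E m omega /\ z = O m /\
      forall k, E k m -> ~ (Subset (O k) y /\ O k <> y))).
  set (I := fun n y => exists m, E m omega /\ (n = m \/ E n m) /\ y = O m).
  assert (Hh : forall n y, E n omega -> I n y ->
    (Subset (h n y) y /\ h n y <> y) /\ exists m, E m omega /\ h n y = O m).
  { intros n y Hn [m [Hm [_ ->]]].
    assert (H : (Subset (h n (O m)) (O m) /\ h n (O m) <> O m) /\
      exists k, E k omega /\ h n (O m) = O k /\
        forall j, E j k -> ~ (Subset (O j) (O m) /\ O j <> O m)).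
    { apply (the_spec (fun z => (Subset z (O m) /\ z <> O m) /\
        exists k, E k omega /\ z = O k /\
        forall j, E j k -> ~ (Subset (O j) (O m) /\ O j <> O m))).
      - destruct (nat_least (fun k => Subset (O k) (O m) /\ O k <> O m))
          as [k [Hk [H1 H2]]]; [def| |exists (O k); eauto 6].
        destruct (Hnc m Hm) as [k [Hk [H1 H2]]]; exists k; split; auto.
      - intros x y [Hx [k [Hk [-> H1]]]] [Hy [k' [Hk' [-> H2]]]].
        destruct (nat_tricho k k' Hk Hk') as [H|[->|H]]; auto.
        + destruct (H2 k H); exact Hx.
        + destruct (H1 k' H); exact Hy. }
    destruct H as [H [k [Hk [H' _]]]]; eauto. }
  destruct (recursion (sep (Power (O empty)) (fun y => exists m, E m omega /\ y = O m))
    (O empty) h I) as [v [Hv [_ [HvS HvI]]]].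
  - unfold h; def.
  - unfold I; def.
  - intros n y Hn [m [Hm [_ ->]]]; rewrite sep_in, Power_in by def.
    split; [apply Hle; auto using zero_omega|eauto].
    destruct (zero_or_pos m Hm); auto.
  - exists empty; auto using zero_omega.
  - intros n y Hn Hy; destruct (Hh n y Hn Hy) as [[H1 H2] [k [Hk H3]]].
    exists k; repeat split; auto.
    destruct Hy as [m [Hm [Hnm ->]]].
    (* The new index [k] lies past [m], because the terms up to [m] contain [O m]. *)
    destruct (nat_tricho m k Hm Hk) as [H|[H|H]].
    + assert (Hs : E (succ m) (succ k)) by (apply succ_mono; auto).
      assert (Hs' : E (succ n) (succ k)).
      { apply succ_mono; auto; destruct Hnm as [->|Hnm]; auto.
        apply (nat_trans k m); auto. }
      apply succ_in in Hs'; tauto.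
    + subst; congruence.
    + destruct H2; apply Subset_antisym; auto; rewrite H3; apply Hle; auto.
  - assert (HS : forall n, E n omega -> Subset (v (succ n)) (v n)).
    { intros n Hn; rewrite HvS by auto; apply (Hh n); auto. }
    exists v; repeat split; auto.
    + intros n k Hn Hk H; apply (decreasing_le v); auto using succ_omega.
      assert (Hs : E (succ n) (succ k)) by (apply succ_mono; auto).
      apply succ_in in Hs; tauto.
    + intros n Hn; rewrite HvS by auto; apply (Hh n); auto.
Qed.

(** * Regular open sets of a space *)

Section Space.
Variables X T : M.
Hypothesis top : Topology X T.

Lemma open_sub U : E U T -> Subset U X.
Proof. apply top. Qed.

Lemma open_whole : E X T.
Proof. apply top. Qed.

Lemma open_cap U V : E U T -> E V T -> E (cap U V) T.
Proof.
  intros HU HV; destruct top as [_ [_ [_ [H _]]]].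
  destruct (H U HU V HV) as [W [HW He]].
  replace (cap U V) with W; auto; apply extensionality; intro z.
  rewrite cap_in; apply He.
Qed.

(** The union of all open subsets of [G] is formed, so no neighbourhoods need to be chosen. *)
Lemma open_nbhd G : (forall x, E x G -> exists V, E V T /\ E x V /\ Subset V G) ->
  E G T.
Proof.
  intro H; destruct top as [_ [_ [_ [_ HU]]]].
  destruct (HU (sep T (fun V => Subset V G))) as [W [HW He]].
  - intros V HV; rewrite sep_in in HV by def; apply HV.
  - replace G with W; auto; apply extensionality; intro z.
    rewrite (He z); split.
    + intros [V [HV Hz]]; rewrite sep_in in HV by def; apply HV, Hz.
    + intro Hz; destruct (H z Hz) as [V [HV [HzV HVG]]]; exists V.
      rewrite sep_in by def; auto.
Qed.

(** The exterior of [U], that is, the complement of its closure; thus [ext (ext U)] is the interior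
    of the closure. *)
Definition ext (U : M) : M :=
  sep X (fun x => exists V, E V T /\ E x V /\ Disjoint V U).

Lemma ext_in U x : E x (ext U) <-> exists V, E V T /\ E x V /\ Disjoint V U.
Proof.
  unfold ext; rewrite sep_in by def; split; [tauto|].
  intros [V [HV [Hx HVU]]]; split; eauto; apply (open_sub V); auto.
Qed.

Lemma Fun1_ext : Fun1 ext.
Proof. unfold ext; def. Qed.
#[local] Hint Resolve Fun1_ext : def.
#[local] Opaque ext.

Lemma ext_open U : E (ext U) T.
Proof.
  apply open_nbhd; intros x Hx; apply ext_in in Hx; destruct Hx as [V [HV [Hx HVU]]].
  exists V; repeat split; auto; intros y Hy; apply ext_in; eauto.
Qed.

Lemma ext_disjoint U x : E x (ext U) -> ~ E x U.
Proof. intros H Hx; apply ext_in in H; destruct H as [V [_ [Hv H]]]; apply H; eauto. Qed.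

Lemma sub_ext V U : E V T -> Disjoint V U -> Subset V (ext U).
Proof. intros HV H x Hx; apply ext_in; eauto. Qed.

Lemma ext_anti U V : Subset U V -> Subset (ext V) (ext U).
Proof.
  intros H; apply sub_ext; [apply ext_open|]; intros [x [H1 H2]].
  apply (ext_disjoint V x); auto.
Qed.

Lemma sub_ext_ext U : E U T -> Subset U (ext (ext U)).
Proof.
  intro H; apply sub_ext; auto; intros [x [H1 H2]]; apply (ext_disjoint U x); auto.
Qed.

(** The reverse inclusion holds for every open set by [sub_ext_ext]. *)
Definition Regular (U : M) : Prop := E U T /\ Subset (ext (ext U)) U.

Lemma regular_open U : Regular U -> E U T.
Proof. intros [H _]; exact H. Qed.

Lemma Def_Regular : Def1 Regular.
Proof. unfold Regular; def. Qed.
#[local] Hint Resolve Def_Regular : def.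

Lemma regular_ext U : E U T -> Regular (ext U).
Proof.
  intro H; split; [apply ext_open|]; apply ext_anti, sub_ext_ext, H.
Qed.

(** Missing the exterior, [V] lies in the closure of [U]; being open, it lies in the interior of
    that closure, which is [U]. *)
Lemma regular_sub U V : Regular U -> E V T -> Disjoint V (ext U) -> Subset V U.
Proof. intros [_ H] HV Hd x Hx; apply H; revert x Hx; apply sub_ext; auto. Qed.

(** Density of [U] together with its exterior, that is, of the complement of the boundary when [U]
    is open. *)
Lemma meets_or_ext U W : E W T -> (exists x, E x W) ->
  exists x, E x W /\ (E x U \/ E x (ext U)).
Proof.
  intros HW [x Hx]; apply NNPP; intro H.
  assert (HWU : Disjoint W U) by (intros [y [H1 H2]]; apply H; eauto).
  apply H; exists x; split; auto; right; apply (sub_ext W U HW HWU x Hx).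
Qed.

(** The gaps [O n \ closure (O (n + 1))] along a strictly decreasing sequence
    of regular open sets are non-empty and pairwise disjoint. *)
Lemma cellular_of_decreasing O : Fun1 O ->
  (forall n, E n omega -> Regular (O n)) ->
  (forall n, E n omega -> Subset (O (succ n)) (O n)) ->
  (forall n, E n omega -> exists m, E m omega /\ E n m /\ O m <> O n) ->
  DenumerablyCellular T.
Proof.
  intros HO Hreg Hdec Hnc.
  destruct (strict_subsequence O HO Hdec Hnc) as [v [Hv [H1 [H2 [H3 H4]]]]].
  assert (Hr : forall n, E n omega -> Regular (v n)).
  { intros n Hn; destruct (H1 n Hn) as [m [Hm [_ ->]]]; auto. }
  set (W := fun n => cap (v n) (ext (v (succ n)))).
  assert (HWo : forall n, E n omega -> E (W n) T).
  { intros n Hn; apply open_cap; [apply regular_open, Hr, Hn|apply ext_open]. }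
  (* If the gap were empty, [v n] would miss the exterior of [v (succ n)] and be included in it by
     regularity. *)
  assert (HWe : forall n, E n omega -> exists x, E x (W n)).
  { intros n Hn; apply NNPP; intro H; apply (H4 n Hn), Subset_antisym; auto.
    apply regular_sub; [auto using succ_omega|apply regular_open, Hr, Hn|].
    intros [x [Hx Hx']]; apply H; exists x; apply cap_in; auto. }
  assert (HWd : forall n k, E n omega -> E k omega -> E n k ->
    forall x, E x (W n) -> ~ E x (W k)).
  { intros n k Hn Hk Hnk x Hx Hx'; apply cap_in in Hx, Hx'.
    apply (ext_disjoint (v (succ n)) x); [apply Hx|].
    apply (H3 n k); auto; apply Hx'. }
  assert (HWd' : forall n k, E n omega -> E k omega ->
    forall x, E x (W n) -> E x (W k) -> n = k).
  { intros n k Hn Hk x Hx Hx'; destruct (nat_tricho n k Hn Hk) as [H|[H|H]]; auto.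
    - destruct (HWd n k Hn Hk H x); auto.
    - destruct (HWd k n Hk Hn H x); auto. }
  assert (HW : Fun1 W) by (unfold W; def).
  assert (HC : forall U, E U (sep T (fun U => exists n, E n omega /\ U = W n)) <->
    exists n, E n omega /\ U = W n).
  { intro U; rewrite sep_in by def; split; [tauto|].
    intros [n [Hn ->]]; eauto. }
  exists (sep T (fun U => exists n, E n omega /\ U = W n)); split; [split|].
  - intros U HU; apply HC in HU; destruct HU as [n [Hn ->]].
    split; auto; apply not_empty; auto.
  - intros U HU V HV Hne [x [Hx Hx']]; apply HC in HU, HV.
    destruct HU as [n [Hn ->]], HV as [k [Hk ->]]; apply Hne; f_equal; eauto.
  - apply (denumerable_range W); auto.
    + intros n Hn; apply HC; eauto.
    + intros n k Hn Hk Heq; destruct (HWe n Hn) as [x Hx].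
      apply (HWd' n k Hn Hk x); [|rewrite <- Heq]; auto.
    + intros U HU; apply HC, HU.
Qed.

(** * Cells cut out by a sequence of finite families *)

Section Tree.
Variable F : M -> M.
Hypothesis Fun1_F : Fun1 F.
Hypothesis F_finite : forall n, E n omega -> Finite (F n).
Hypothesis F_regular : forall n U, E n omega -> E U (F n) -> Regular U.
Hypothesis F_inj : forall n k, E n omega -> E k omega -> F n = F k -> n = k.
#[local] Hint Resolve Fun1_F : def.

(** The bound [succ n] lets [F n] itself count at level n; cutting the union out of [T] makes it a
    set by Separation. *)
Definition upto (n : M) : M :=
  sep T (fun U => exists i, E i (succ n) /\ E U (F i)).
Definition total : M := sep T (fun U => exists i, E i omega /\ E U (F i)).

Lemma upto_in n U : E n omega ->
  E U (upto n) <-> exists i, E i (succ n) /\ E U (F i).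
Proof.
  intro Hn; unfold upto; rewrite sep_in by def; split; [tauto|].
  intros [i [Hi HU]]; split; eauto; apply regular_open, (F_regular i); auto.
  apply (omega_trans (succ n)); auto using succ_omega.
Qed.

Lemma total_in U : E U total <-> exists i, E i omega /\ E U (F i).
Proof.
  unfold total; rewrite sep_in by def; split; [tauto|].
  intros [i [Hi HU]]; split; eauto; apply regular_open, (F_regular i); auto.
Qed.

Lemma Fun1_upto : Fun1 upto.
Proof. unfold upto; def. Qed.
#[local] Hint Resolve Fun1_upto : def.
#[local] Opaque upto total.

Lemma total_regular U : E U total -> Regular U.
Proof. intro H; apply total_in in H; destruct H as [i [Hi H]]; eauto. Qed.

Lemma upto_total n : E n omega -> Subset (upto n) total.
Proof.
  intros Hn U HU; apply upto_in in HU; auto; apply total_in.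
  destruct HU as [i [Hi HU]]; exists i; split; auto.
  apply (omega_trans (succ n)); auto using succ_omega.
Qed.

Lemma total_upto U : E U total -> exists n, E n omega /\ E U (upto n).
Proof.
  intro H; apply total_in in H; destruct H as [n [Hn HU]]; exists n; split; auto.
  apply upto_in; auto; exists n; split; auto; apply succ_in; auto.
Qed.

Lemma upto_mono n : E n omega -> Subset (upto n) (upto (succ n)).
Proof.
  intros Hn U HU; apply upto_in in HU; auto; apply upto_in; auto using succ_omega.
  destruct HU as [i [Hi HU]]; exists i; split; auto; apply succ_in; auto.
Qed.

Lemma upto_finite n : E n omega -> Finite (upto n).
Proof.
  revert n; apply (omega_ind (fun n => Finite (upto n))); [def| |].
  - apply finite_sub with (F empty); [apply F_finite, zero_omega|].
    intros U HU; apply upto_in in HU; [|apply zero_omega].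
    destruct HU as [i [Hi HU]]; apply succ_in in Hi; destruct Hi as [Hi| ->]; auto.
    destruct (empty_in i Hi).
  - intros n Hn IH; apply finite_sub with (cup (upto n) (F (succ n))).
    + apply finite_cup; auto using succ_omega.
    + intros U HU; apply upto_in in HU; auto using succ_omega; apply cup_in.
      destruct HU as [i [Hi HU]]; apply succ_in in Hi; destruct Hi as [Hi| ->]; auto.
      left; apply upto_in; eauto.
Qed.

(** A finite set has a finite power set, whereas the sets [F n] are infinitely many distinct subsets
    of [total]. *)
Lemma total_infinite : ~ Finite total.
Proof.
  intro H; apply finite_Power in H; revert H; apply (inj_infinite F); auto.
  intros n Hn; apply Power_in; intros U HU; apply total_in; eauto.
Qed.

(** [settled S] is the open dense set of the points off the boundaries of the
    members of [S]; [atom S x] is the atom around [x] of the algebra of regular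
    open sets generated by [S]. *)
Definition settled (S : M) : M :=
  sep X (fun x => forall U, E U S -> E x U \/ E x (ext U)).
Definition atom (S x : M) : M :=
  sep X (fun y => forall U, E U S ->
    (E x U -> E y U) /\ (E x (ext U) -> E y (ext U))).

Lemma settled_in S x :
  E x (settled S) <-> E x X /\ forall U, E U S -> E x U \/ E x (ext U).
Proof. apply (sep_in (fun x => forall U, E U S -> E x U \/ E x (ext U))); def. Qed.

Lemma atom_in S x y : E y (atom S x) <-> E y X /\ forall U, E U S ->
  (E x U -> E y U) /\ (E x (ext U) -> E y (ext U)).
Proof.
  apply (sep_in (fun y => forall U, E U S ->
    (E x U -> E y U) /\ (E x (ext U) -> E y (ext U)))); def.
Qed.

Lemma Fun1_settled : Fun1 settled.
Proof. unfold settled; def. Qed.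
Lemma Fun2_atom : Fun2 atom.
Proof. unfold atom; def. Qed.
#[local] Hint Resolve Fun1_settled Fun2_atom : def.
#[local] Opaque settled atom.

(** Adjoining [u] to [S] intersects the settled set with the open dense union of [u] and [ext u], so
    induction over the finite set [S] applies. *)
Lemma settled_open_dense S : Finite S -> Subset S T ->
  E (settled S) T /\ forall W, E W T -> (exists x, E x W) ->
    exists x, E x W /\ E x (settled S).
Proof.
  revert S; apply (finite_ind (fun S => Subset S T ->
    E (settled S) T /\ forall W, E W T -> (exists x, E x W) ->
    exists x, E x W /\ E x (settled S))); [def| |].
  - intros _; replace (settled empty) with X.
    + split; [apply open_whole|]; intros W HW [x Hx]; exists x; split; auto.
      apply (open_sub W); auto.
    + apply extensionality; intro z; rewrite settled_in; split; [|tauto].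
      intro Hz; split; auto; intros U HU; destruct (empty_in U HU).
  - intros S u IH HS; destruct IH as [IH1 IH2].
    { intros x Hx; apply HS, adjoin_in; auto. }
    assert (Hu : E u T) by (apply HS, adjoin_in; auto).
    assert (Hz : forall z, E z (settled (adjoin S u)) <->
      E z (settled S) /\ (E z u \/ E z (ext u))).
    { intro z; rewrite !settled_in; split.
      - intros [H1 H2]; repeat split; auto; intros; apply H2, adjoin_in; auto.
      - intros [[H1 H2] H3]; split; auto; intros U HU; apply adjoin_in in HU.
        destruct HU as [HU| ->]; auto. }
    split.
    + apply open_nbhd; intros x Hx; apply Hz in Hx; destruct Hx as [H1 [H2|H2]].
      * exists (cap (settled S) u); repeat split; [apply open_cap; auto| |].
        -- apply cap_in; auto.
        -- intros y Hy; apply cap_in in Hy; apply Hz; tauto.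
      * exists (cap (settled S) (ext u)); repeat split.
        -- apply open_cap; auto using ext_open.
        -- apply cap_in; auto.
        -- intros y Hy; apply cap_in in Hy; apply Hz; tauto.
    + intros W HW HWe; destruct (IH2 W HW HWe) as [x [Hx Hx']].
      destruct (meets_or_ext u (cap W (settled S))) as [y [Hy Hy']].
      * apply open_cap; auto.
      * exists x; apply cap_in; auto.
      * apply cap_in in Hy; exists y; rewrite Hz; tauto.
Qed.

Lemma atom_open S x : Finite S -> Subset S T -> E (atom S x) T.
Proof.
  revert S; apply (finite_ind (fun S => Subset S T -> E (atom S x) T)); [def| |].
  - intros _; replace (atom empty x) with X; [apply open_whole|].
    apply extensionality; intro z; rewrite atom_in; split; [|tauto].
    intro Hz; split; auto; intros U HU; destruct (empty_in U HU).
  - intros S u IH HS.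
    assert (HS' : E (atom S x) T).
    { apply IH; intros y Hy; apply HS, adjoin_in; auto. }
    assert (Hu : E u T) by (apply HS, adjoin_in; auto).
    assert (Hz : forall z, E z (atom (adjoin S u) x) <-> E z (atom S x) /\
      (E x u -> E z u) /\ (E x (ext u) -> E z (ext u))).
    { intro z; rewrite !atom_in; split.
      - intros [H1 H2]; split; [split|]; auto; intros; apply H2, adjoin_in; auto.
      - intros [[H1 H2] H3]; split; auto; intros U HU; apply adjoin_in in HU.
        destruct HU as [HU| ->]; auto. }
    destruct (classic (E x u)) as [Hxu|Hxu].
    + replace (atom (adjoin S u) x) with (cap (atom S x) u); [apply open_cap; auto|].
      apply extensionality; intro z; rewrite Hz, cap_in.
      assert (H := ext_disjoint u x); tauto.
    + destruct (classic (E x (ext u))) as [Hxe|Hxe].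
      * replace (atom (adjoin S u) x) with (cap (atom S x) (ext u));
          [apply open_cap; auto using ext_open|].
        apply extensionality; intro z; rewrite Hz, cap_in; tauto.
      (* Here [x] lies on the boundary of [u], and [u] imposes no condition. *)
      * replace (atom (adjoin S u) x) with (atom S x); auto.
        apply extensionality; intro z; rewrite Hz; tauto.
Qed.

(** The operation [ext (ext _)] is monotone, so it leads out of none of the regular sets [U] and
    [ext U] whose intersection is the atom. *)
Lemma atom_regular S x : Finite S -> (forall U, E U S -> Regular U) ->
  Regular (atom S x).
Proof.
  intros HS HR; assert (Ho : E (atom S x) T).
  { apply atom_open; auto; intros U HU; apply regular_open, HR, HU. }
  split; auto; intros y Hy; apply atom_in; split.
  { apply (open_sub _ (ext_open _) _ Hy). }
  intros U HU; split; intro Hx.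
  - apply (HR U HU); revert y Hy; apply ext_anti, ext_anti.
    intros z Hz; apply atom_in in Hz; apply Hz; auto.
  - apply (regular_ext U); [apply regular_open, HR, HU|]; revert y Hy; apply ext_anti, ext_anti.
    intros z Hz; apply atom_in in Hz; apply Hz; auto.
Qed.

Lemma atom_refl S x : E x X -> E x (atom S x).
Proof. intro H; apply atom_in; auto. Qed.

(** At a settled [x] each member of [S] is decided, and [y] inherits every decision. Hence the atoms
    of settled points partition the settled set. *)
Lemma settled_atom S x y : E x (settled S) -> E y (atom S x) ->
  E y (settled S) /\ atom S y = atom S x.
Proof.
  intros Hx Hy; apply settled_in in Hx; apply atom_in in Hy.
  destruct Hx as [Hx Hx'], Hy as [Hy Hy']; split.
  - apply settled_in; split; auto; intros U HU.
    destruct (Hx' U HU), (Hy' U HU); tauto.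
  - apply extensionality; intro z; rewrite !atom_in; split; intros [Hz Hz'].
    + split; auto; intros U HU; destruct (Hy' U HU), (Hz' U HU); tauto.
    + split; auto; intros U HU; assert (H := ext_disjoint U y).
      destruct (Hx' U HU), (Hy' U HU), (Hz' U HU); tauto.
Qed.

Lemma settled_anti S S' : Subset S S' -> Subset (settled S') (settled S).
Proof.
  intros H x Hx; apply settled_in in Hx; apply settled_in; destruct Hx; split; auto.
Qed.

Lemma atom_anti S S' x : Subset S S' -> Subset (atom S' x) (atom S x).
Proof.
  intros H y Hy; apply atom_in in Hy; apply atom_in; destruct Hy; split; auto.
Qed.

Definition level (n : M) : M := settled (upto n).
Definition cell (n x : M) : M := atom (upto n) x.

Lemma Fun1_level : Fun1 level. Proof. unfold level; def. Qed.
Lemma Fun2_cell : Fun2 cell. Proof. unfold cell; def. Qed.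
#[local] Hint Resolve Fun1_level Fun2_cell : def.

Lemma upto_open n : E n omega -> Subset (upto n) T.
Proof. intros Hn U HU; apply regular_open, total_regular, (upto_total n); auto. Qed.

Lemma level_open n : E n omega -> E (level n) T.
Proof. intro Hn; apply settled_open_dense; auto using upto_finite, upto_open. Qed.

Lemma level_dense n W : E n omega -> E W T -> (exists x, E x W) ->
  exists x, E x W /\ E x (level n).
Proof. intro Hn; apply settled_open_dense; auto using upto_finite, upto_open. Qed.

Lemma level_dec n : E n omega -> Subset (level (succ n)) (level n).
Proof. intro Hn; apply settled_anti, upto_mono, Hn. Qed.

Lemma level_sub n x : E x (level n) -> E x X.
Proof. intro H; apply settled_in in H; apply H. Qed.

Lemma cell_regular n x : E n omega -> Regular (cell n x).
Proof.
  intro Hn; apply atom_regular; auto using upto_finite.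
  intros U HU; apply total_regular, (upto_total n); auto.
Qed.

Lemma cell_dec n x : E n omega -> Subset (cell (succ n) x) (cell n x).
Proof. intro Hn; apply atom_anti, upto_mono, Hn. Qed.

Lemma upto_le n k : E n omega -> E k omega -> n = k \/ E n k ->
  Subset (upto n) (upto k).
Proof.
  intros Hn Hk [->|H]; [intros x Hx; exact Hx|].
  intros U HU; apply upto_in in HU; auto; apply upto_in; auto.
  destruct HU as [i [Hi HU]]; exists i; split; auto; apply succ_in; left.
  apply succ_in in Hi; destruct Hi as [Hi| ->]; auto.
  apply (nat_trans k n); auto.
Qed.

(** * Stable cells, and regions without them *)

Definition Stable (A : M) : Prop :=
  forall U, E U total -> Subset A U \/ Subset A (ext U).

Lemma Def_Stable : Def1 Stable. Proof. unfold Stable; def. Qed.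
#[local] Hint Resolve Def_Stable : def.

Lemma stable_sub A B : Subset A B -> Stable B -> Stable A.
Proof.
  intros H HB U HU; destruct (HB U HU) as [H'|H']; [left|right];
    intros x Hx; apply H', H, Hx.
Qed.

Definition stable_part (n : M) : M := sep (level n) (fun x => Stable (cell n x)).

Lemma stable_part_in n x :
  E x (stable_part n) <-> E x (level n) /\ Stable (cell n x).
Proof. apply (sep_in (fun x => Stable (cell n x))); def. Qed.

Lemma Fun1_stable_part : Fun1 stable_part.
Proof. unfold stable_part; def. Qed.
#[local] Hint Resolve Fun1_stable_part : def.
#[local] Opaque stable_part.

Lemma stable_part_open n : E n omega -> E (stable_part n) T.
Proof.
  intro Hn; apply open_nbhd; intros x Hx; apply stable_part_in in Hx.
  destruct Hx as [Hx Hs]; exists (cell n x); repeat split.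
  - apply regular_open, cell_regular, Hn.
  - apply atom_refl, (level_sub n), Hx.
  - intros y Hy; destruct (settled_atom (upto n) x y) as [H1 H2]; auto.
    apply stable_part_in; split; auto; unfold cell; rewrite H2; exact Hs.
Qed.

(** A stable cell meets the boundary of no member of [total], so its points stay settled at the next
    level, and the smaller cells there inherit stability. *)
Lemma stable_part_inc n : E n omega ->
  Subset (stable_part n) (stable_part (succ n)).
Proof.
  intros Hn x Hx; apply stable_part_in in Hx; apply stable_part_in.
  destruct Hx as [Hx Hs]; split.
  - apply settled_in; split; [apply (level_sub n), Hx|].
    intros U HU; assert (HU' : E U total).
    { apply (upto_total (succ n)); auto using succ_omega. }
    assert (Hxx : E x (cell n x)) by apply atom_refl, (level_sub n), Hx.
    destruct (Hs U HU') as [H|H]; auto.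
  - apply stable_sub with (cell n x); auto; apply cell_dec, Hn.
Qed.

(** If all cells of level [n] were stable, a member of [total] would be
    determined by the traces on [upto n] of its settled points. *)
Lemma unstable_point n : E n omega -> exists x, E x (level n) /\ ~ Stable (cell n x).
Proof.
  intro Hn; apply NNPP; intro H.
  assert (Hst : forall x, E x (level n) -> Stable (cell n x)).
  { intros x Hx; apply NNPP; intro H'; apply H; eauto. }
  apply total_infinite.
  set (trace := fun x => sep (upto n) (fun U => E x U)).
  set (f := fun U => sep (Power (upto n))
    (fun R => exists x, E x U /\ E x (level n) /\ R = trace x)).
  assert (Htr : Fun1 trace) by (unfold trace; def).
  assert (Hf : Fun1 f) by (unfold f; def).
  (* The map [f] sends a member of [total] to the set of traces of its settled points; it is to be
     shown injective into a finite set. *)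
  apply (finite_inj f total (Power (Power (upto n)))); auto.
  - apply finite_Power, finite_Power, upto_finite, Hn.
  - intros U HU; apply Power_in; intros R HR; unfold f in HR.
    rewrite sep_in in HR by def; apply HR.
  (* Otherwise U ∩ [ext V] is a non-empty open set and contains a settled point x. Equality of the
     codes gives a settled y in V with the trace of x, hence in the cell of x, and V splits this
     cell. *)
  - assert (Hsub : forall U V, E U total -> E V total -> f U = f V -> Subset U V).
    { intros U V HU HV Heq.
      apply regular_sub;
        [apply total_regular, HV|apply regular_open, total_regular, HU|].
      intros [x0 Hx0].
      destruct (level_dense n (cap U (ext V))) as [x [Hx Hxl]]; auto.
      { apply open_cap; [apply regular_open, total_regular, HU|apply ext_open]. }
      { exists x0; apply cap_in, Hx0. }
      apply cap_in in Hx; destruct Hx as [HxU HxV].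
      assert (HR : E (trace x) (f V)).
      { rewrite <- Heq; unfold f; rewrite sep_in by def; split; eauto.
        apply Power_in; intros W HW; unfold trace in HW.
        rewrite sep_in in HW by def; apply HW. }
      unfold f in HR; rewrite sep_in in HR by def.
      destruct HR as [_ [y [HyV [Hyl Hxy]]]].
      assert (Hyx : E y (cell n x)).
      { apply atom_in; split; [apply (level_sub n), Hyl|]; intros W HW.
        assert (HWxy : E x W <-> E y W).
        { assert (HWx : E W (trace x) <-> E W (trace y)) by (rewrite Hxy; tauto).
          unfold trace in HWx; rewrite !sep_in in HWx by def; tauto. }
        split; [apply HWxy|]; intro HxW; apply settled_in in Hyl.
        destruct Hyl as [_ Hyl]; destruct (Hyl W HW) as [HyW|HyW]; auto.
        apply HWxy in HyW; destruct (ext_disjoint W x); auto. }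
      assert (Hxx : E x (cell n x)) by apply atom_refl, (level_sub n), Hxl.
      destruct (Hst x Hxl V HV) as [Hc|Hc].
      - apply (ext_disjoint V x); auto.
      - apply (ext_disjoint V y); auto. }
    intros U V HU HV Heq; apply Subset_antisym; auto.
Qed.

(** Each member of [total] belongs to [upto m] for some m past n; if the cell were still a cell of
    each such level, no member could split it. All [y] are allowed because the points of a branch
    vary with the level. *)
Lemma unstable_cell_shrinks n x : E n omega -> ~ Stable (cell n x) ->
  exists m, E m omega /\ E n m /\ forall y, E y (level m) -> cell m y <> cell n x.
Proof.
  intros Hn Hs; apply NNPP; intro H; apply Hs; intros U HU.
  destruct (total_upto U HU) as [k [Hk HkU]].
  destruct (nat_upper (succ n) k) as [m [Hm [H1 H2]]]; auto using succ_omega.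
  assert (Hnm : E n m).
  { assert (Hns : E n (succ n)) by (apply succ_in; auto).
    destruct H1 as [<-|H1]; auto; apply (nat_trans m (succ n)); auto. }
  apply NNPP; intro H3; apply H; exists m; repeat split; auto.
  intros y Hy Heq; apply H3; rewrite <- Heq.
  assert (HU' : E U (upto m)) by (apply (upto_le k m); auto).
  apply settled_in in Hy; destruct Hy as [_ Hy].
  destruct (Hy U HU') as [Hy'|Hy']; [left|right]; intros z Hz;
    apply atom_in in Hz; apply Hz; auto.
Qed.

(** The exteriors of the stable parts decrease; if they become constant, no
    cell inside their final value is stable. *)
Lemma unstable_region : ~ DenumerablyCellular T ->
  exists O, E O T /\ (exists x, E x O) /\
    forall n x, E n omega -> E x O -> E x (level n) -> ~ Stable (cell n x).
Proof.
  intro Hdc.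
  assert (Hdec : forall n, E n omega ->
    Subset (ext (stable_part (succ n))) (ext (stable_part n))).
  { intros n Hn; apply ext_anti, stable_part_inc, Hn. }
  assert (Hconst : exists n, E n omega /\ forall m, E m omega -> E n m ->
    ext (stable_part m) = ext (stable_part n)).
  { apply NNPP; intro H; apply Hdc.
    apply (cellular_of_decreasing (fun n => ext (stable_part n))); [def| |exact Hdec|].
    - intros n Hn; apply regular_ext, stable_part_open, Hn.
    - intros n Hn; apply NNPP; intro H'; apply H; exists n; split; [exact Hn|].
      intros m Hm Hnm; apply NNPP; intro H1; apply H'; exists m; auto. }
  destruct Hconst as [n0 [Hn0 Hc]]; exists (ext (stable_part n0)); repeat split.
  - apply ext_open.
  (* An unstable cell of level [n0] is open and disjoint from the stable part, hence included in its
     exterior. *)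
  - destruct (unstable_point n0 Hn0) as [x [Hx Hs]]; exists x.
    apply (sub_ext (cell n0 x)); [apply regular_open, cell_regular, Hn0| |].
    + intros [y [Hy Hy']]; apply Hs; apply stable_part_in in Hy'.
      destruct (settled_atom (upto n0) x y) as [_ H]; auto.
      unfold cell; rewrite <- H; apply Hy'.
    + apply atom_refl, (level_sub n0), Hx.
  - intros n x Hn Hx Hxl Hs.
    assert (Hxs : E x (stable_part n)) by (apply stable_part_in; auto).
    (* The region lies in the exterior of every stable part: of the earlier ones by monotonicity, of
       the later ones by constancy. *)
    apply (ext_disjoint (stable_part n) x); [|exact Hxs].
    destruct (nat_tricho n n0 Hn Hn0) as [H|[->|H]]; [|exact Hx|].
    + apply (decreasing_le (fun n => ext (stable_part n))) with n0;
        [def|exact Hdec|exact Hn|exact Hn0|right; exact H|exact Hx].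
    + rewrite (Hc n Hn H); exact Hx.
Qed.

(** The point [d (succ n)] lies in the cell of [d n], so both have the same cell of level n and the
    cells decrease; instability keeps them from becoming constant. *)
Lemma cellular_of_branch d : Fun1 d ->
  (forall n, E n omega -> E (d n) (level n) /\ ~ Stable (cell n (d n))) ->
  (forall n, E n omega -> E (d (succ n)) (cell n (d n))) ->
  DenumerablyCellular T.
Proof.
  intros Hd H1 H2; apply (cellular_of_decreasing (fun n => cell n (d n))); [def|..].
  - intros n Hn; apply cell_regular, Hn.
  - intros n Hn; destruct (settled_atom (upto n) (d n) (d (succ n))) as [_ H].
    + apply H1, Hn.
    + apply H2, Hn.
    + unfold cell at 2; rewrite <- H; apply cell_dec, Hn.
  - intros n Hn; destruct (unstable_cell_shrinks n (d n) Hn) as [m [Hm [Hnm H]]].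
    + apply H1, Hn.
    + exists m; repeat split; auto; apply H, H1, Hm.
Qed.

(** A point of the unstable region that is settled at all levels serves as a constant branch. *)
Lemma cellular_of_generic_points :
  (forall W, E W T -> (exists x, E x W) ->
    exists x, E x W /\ forall n, E n omega -> E x (level n)) ->
  DenumerablyCellular T.
Proof.
  intro H; apply NNPP; intro Hdc.
  destruct (unstable_region Hdc) as [O [HO [HOe Hs]]].
  destruct (H O HO HOe) as [x [Hx Hl]].
  apply Hdc, (cellular_of_branch (fun _ => x)); [def| |].
  - intros n Hn; auto.
  - intros n Hn; apply atom_refl, (open_sub O); auto.
Qed.

(** The well-order replaces dependent choice: the next point is the least element of [D] in the
    non-empty open set of those points of the region and the present cell that are settled at the
    next level. *)
Lemma cellular_of_well_orderable_dense D : Dense X T D -> WellOrderable D ->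
  DenumerablyCellular T.
Proof.
  intros [HDX HD] [R [_ [_ [Hanti [_ [_ Hmin]]]]]]; apply NNPP; intro Hdc.
  destruct (unstable_region Hdc) as [O [HO [HOe Hs]]].
  set (least := fun W => the (fun d => (E d D /\ E d W) /\
    forall d', E d' D /\ E d' W -> Related R d d')).
  assert (Hl : forall W, E W T -> (exists x, E x W) ->
    E (least W) D /\ E (least W) W).
  { intros W HW HWe.
    assert (H : (E (least W) D /\ E (least W) W) /\
      forall d', E d' D /\ E d' W -> Related R (least W) d'); [|apply H].
    apply (the_spec (fun d => (E d D /\ E d W) /\
      forall d', E d' D /\ E d' W -> Related R d d')).
    - destruct (Hmin (cap D W)) as [m [Hm Hm']].
      + split; [intros x Hx; apply cap_in in Hx; apply Hx|].
        apply not_empty; apply NNPP; intro H.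
        apply (HD W HW); [apply not_empty, HWe|].
        intros [x [H1 H2]]; apply H; exists x; apply cap_in; auto.
      + apply cap_in in Hm; exists m; split; auto.
        intros d' Hd'; apply Hm', cap_in; auto.
    - intros x y [Hx Hx'] [Hy Hy']; apply Hanti; try tauto; auto. }
  assert (Hleast : Fun1 least) by (unfold least; def).
  set (h := fun n d => least (cap (cap O (cell n d)) (level (succ n)))).
  assert (Hh : Fun2 h) by (unfold h; def).
  set (I := fun n d => E d D /\ E d O /\ E d (level n)).
  assert (Hstep : forall n d, E n omega -> I n d ->
    I (succ n) (h n d) /\ E (h n d) (cell n d)).
  { intros n d Hn [Hd [HdO Hdl]].
    assert (Ho : E (cap O (cell n d)) T) .
    { apply open_cap; auto; apply regular_open, cell_regular, Hn. }
    destruct (level_dense (succ n) (cap O (cell n d))) as [x [Hx Hx']];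
      auto using succ_omega.
    { exists d; apply cap_in; split; auto; apply atom_refl, HDX, Hd. }
    destruct (Hl (cap (cap O (cell n d)) (level (succ n)))) as [H1 H2].
    - apply open_cap; auto using level_open, succ_omega.
    - exists x; apply cap_in; auto.
    - fold (h n d) in H1, H2; apply cap_in in H2; destruct H2 as [H2 H3].
      apply cap_in in H2; unfold I; tauto. }
  destruct (level_dense empty O zero_omega HO HOe) as [x0 Hx0].
  destruct (Hl (cap O (level empty))) as [H1 H2].
  { apply open_cap; auto using level_open, zero_omega. }
  { exists x0; apply cap_in, Hx0. }
  apply cap_in in H2.
  destruct (recursion D (least (cap O (level empty))) h I) as [v [Hv [_ [HvS HvI]]]].
  - exact Hh.
  - unfold I; def.
  - intros n y _ [Hy _]; exact Hy.
  - unfold I; tauto.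
  - intros n y Hn Hy; apply Hstep; auto.
  - apply Hdc, (cellular_of_branch v Hv).
    + intros n Hn; destruct (HvI n Hn) as [_ [HO' Hl']]; auto.
    + intros n Hn; rewrite HvS by auto; apply Hstep; auto.
Qed.

End Tree.
End Space.

(** * The four classes of spaces *)

Lemma separating_infinite X K : ~ Finite X ->
  (forall x y, E x X -> E y X -> x <> y -> exists U, E U K /\ E x U /\ ~ E y U) ->
  ~ Finite K.
Proof.
  intros HX H HK; apply HX.
  (* A point is determined by the members of [K] that contain it, so a finite [K] would embed [X]
     into a finite power set. *)
  apply (finite_inj (fun x => sep K (fun U => E x U)) X (Power K)).
  - def.
  - apply finite_Power, HK.
  - intros x _; apply Power_in; intros U HU; rewrite sep_in in HU by def; apply HU.
  - intros x y Hx Hy Heq; apply NNPP; intro Hne.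
    destruct (H x y Hx Hy Hne) as [U [HU [HxU HyU]]]; apply HyU.
    assert (HU' : E U (sep K (fun U => E x U))) by (rewrite sep_in by def; auto).
    rewrite Heq, sep_in in HU' by def; apply HU'.
Qed.

(** For disjoint neighbourhoods U of x and V of y, the regular set [ext V] contains U and misses y;
    thus regular open sets separate points. *)
Lemma regular_infinite X T : InfiniteHausdorff X T ->
  ~ Finite (sep T (Regular X T)).
Proof.
  intros [Ht [Hh Hi]]; apply (separating_infinite X); auto.
  intros x y Hx Hy Hne.
  destruct (Hh x Hx y Hy Hne) as [U [HU [V [HV [HxU [HyV Hd]]]]]].
  assert (Hr := regular_ext X T Ht V HV).
  exists (ext X T V); rewrite sep_in by (apply Def_Regular).
  split; [split; [apply (ext_open X T Ht)|exact Hr]|split].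
  - apply (sub_ext X T Ht U V); auto.
  - intro H; apply (ext_disjoint X T Ht V y); auto.
Qed.

Lemma regular_sequence X T Q : HoldsIQDI -> ~ Finite Q ->
  (forall U, E U Q -> Regular X T U) ->
  exists F, Fun1 F /\ (forall n, E n omega -> Finite (F n)) /\
    (forall n U, E n omega -> E U (F n) -> E U Q /\ Regular X T U) /\
    (forall n k, E n omega -> E k omega -> F n = F k -> n = k).
Proof.
  intros HI HQ Hr; destruct (IQDI_sequence Q HI HQ) as [F [HF [H1 H2]]].
  exists F; split; [exact HF|]; split; [intros n Hn; apply H1, Hn|]; split; auto.
  intros n U Hn HU; assert (HUQ : E U Q) by (apply (H1 n Hn), HU); auto.
Qed.

Lemma well_orderable_dense_case_holds : HoldsIQDI -> WellOrderableDenseCase.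
Proof.
  intros HI X T [HX [D [HD Hwo]]]; assert (Ht := proj1 HX).
  destruct (regular_sequence X T (sep T (Regular X T)) HI (regular_infinite X T HX))
    as [F [HF [H1 [H2 H3]]]].
  - intros U HU; rewrite sep_in in HU by (apply Def_Regular); apply HU.
  - apply (cellular_of_well_orderable_dense X T Ht F HF H1
      (fun n U Hn HU => proj2 (H2 n U Hn HU)) H3 D HD Hwo).
Qed.

Lemma infinite_Clop_case_holds : HoldsIQDI -> InfiniteClopCase.
Proof.
  intros HI X T [HX [K [HK Hinf]]]; assert (Ht := proj1 HX).
  (* A clopen set has no boundary. This gives both its regularity and that every point is settled at
     every level. *)
  assert (Hc : forall U, E U K -> forall x, E x X -> E x U \/ E x (ext X T U)).
  { intros U HU x Hx; apply HK in HU; destruct HU as [HU [V [HV HVU]]].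
    destruct (classic (E x U)) as [H|H]; auto; right.
    apply (sub_ext X T Ht V U); auto; [|apply HVU; auto].
    intros [y [Hy Hy']]; apply HVU in Hy; tauto. }
  destruct (regular_sequence X T K HI Hinf) as [F [HF [H1 [H2 H3]]]].
  - intros U HU; assert (HUT : E U T) by (apply HK, HU); split; auto.
    intros x Hx; destruct (Hc U HU x) as [H|H]; auto.
    + apply (open_sub X T Ht (ext X T (ext X T U))); [|exact Hx].
      apply (ext_open X T Ht).
    + destruct (ext_disjoint X T Ht (ext X T U) x Hx H).
  - apply (cellular_of_generic_points X T Ht F HF H1
      (fun n U Hn HU => proj2 (H2 n U Hn HU)) H3).
    intros W HW [x Hx]; exists x; split; auto; intros n Hn.
    apply (settled_in X T); split; [apply (open_sub X T Ht W); auto|].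
    intros U HU; apply Hc; [|apply (open_sub X T Ht W); auto].
    apply (upto_in X T F HF (fun n U Hn HU => proj2 (H2 n U Hn HU))) in HU; auto.
    destruct HU as [i [Hi HU]]; refine (proj1 (H2 i U _ HU)).
    apply (omega_trans (succ n)); auto using succ_omega.
Qed.

(** Clopen basic neighbourhoods separate the points of a Hausdorff space, so there are infinitely
    many clopen sets and the preceding case applies. *)
Lemma zero_dimensional_case_holds : HoldsIQDI -> ZeroDimensionalCase.
Proof.
  intros HI X T [HX [B [[HBT HB] Hclop]]].
  apply (infinite_Clop_case_holds HI X); split; [exact HX|].
  exists (sep T (Clopen X T)); split.
  - intro U; rewrite sep_in by def; split; [tauto|].
    intro HU; split; auto; apply HU.
  - apply (separating_infinite X); [apply HX|]; intros x y Hx Hy Hne.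
    destruct HX as [Ht [Hh _]].
    destruct (Hh x Hx y Hy Hne) as [U [HU [V [HV [HxU [HyV Hd]]]]]].
    destruct (HB U HU) as [S [HS Hu]]; apply Hu in HxU.
    destruct HxU as [b [HbS Hxb]]; exists b; rewrite sep_in by def.
    assert (Hb : Clopen X T b) by (apply Hclop, HS, HbS).
    repeat split; auto; try apply Hb.
    intro Hyb; apply Hd; exists y; split; auto; apply Hu; eauto.
Qed.

(** A strictly decreasing subsequence of the dense open sets is denumerable, as
    the definition of Baire spaces requires of an infinite family. *)
Lemma baire_case_holds : HoldsIQDI -> BaireCase.
Proof.
  intros HI X T [HX HB]; assert (Ht := proj1 HX).
  destruct (regular_sequence X T (sep T (Regular X T)) HI (regular_infinite X T HX))
    as [F [HF [H1 [H2' H3]]]].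
  { intros U HU; rewrite sep_in in HU by (apply Def_Regular); apply HU. }
  assert (H2 := fun n U Hn HU => proj2 (H2' n U Hn HU)); clear H2'.
  apply (cellular_of_generic_points X T Ht F HF H1 H2 H3).
  intros W HW HWe; set (L := level X T F).
  assert (HL : Fun1 L) by (apply Fun1_level, HF).
  assert (Hdec : forall n, E n omega -> Subset (L (succ n)) (L n)).
  { intros n Hn; apply level_dec; auto. }
  assert (Hle := decreasing_le L HL Hdec).
  destruct (classic (forall n, E n omega ->
    exists m, E m omega /\ E n m /\ L m <> L n)) as [Hs|Hs].
  - destruct (strict_subsequence L HL Hdec Hs) as [v [Hv [K1 [K2 [K3 K4]]]]].
    set (G := sep T (fun U => exists n, E n omega /\ U = v n)).
    assert (HvT : forall n, E n omega -> E (v n) T).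
    { intros n Hn; destruct (K1 n Hn) as [m [Hm [_ ->]]]; apply level_open; auto. }
    assert (HG : forall U, E U G <-> exists n, E n omega /\ U = v n).
    { intro U; unfold G; rewrite sep_in by def; split; [tauto|].
      intros [n [Hn ->]]; eauto. }
    assert (Hlt : forall n k, E n omega -> E k omega -> E n k -> v n <> v k).
    { intros n k Hn Hk Hnk Heq; apply (K4 n Hn), Subset_antisym; auto.
      rewrite Heq at 1; auto. }
    assert (Hdense : forall U, E U G -> E U T /\ Dense X T U).
    { intros U HU; apply HG in HU; destruct HU as [n [Hn ->]]; split; auto.
      split; [apply (open_sub X T Ht); auto|]; intros V HV HVe Hd.
      destruct (K1 n Hn) as [m [Hm [_ He]]].
      destruct (level_dense X T Ht F HF H1 H2 m V) as [x [Hx Hx']]; auto;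
        [apply not_empty, HVe|].
      apply Hd; exists x; rewrite He; auto. }
    assert (Hden : Denumerable G).
    { apply (denumerable_range v); auto.
      - intros n Hn; apply HG; eauto.
      - intros n k Hn Hk Heq; destruct (nat_tricho n k Hn Hk) as [H|[H|H]]; auto.
        + destruct (Hlt n k); auto.
        + destruct (Hlt k n); auto.
      - intros U HU; apply HG, HU. }
    destruct (HB G (conj (or_intror Hden) Hdense)
      (sep X (fun x => forall U, E U G -> E x U))) as [_ HI'].
    { intro x; rewrite sep_in by def; tauto. }
    apply NNPP; intro Hn; apply (HI' W HW); [apply not_empty, HWe|].
    intros [x [Hx Hx']]; rewrite sep_in in Hx' by def; destruct Hx' as [_ Hx'].
    apply Hn; exists x; split; auto; intros n Hn'.
    (* The subsequence has the same intersection as all levels, since [v n] is a level at or past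
       n. *)
    destruct (K1 n Hn') as [m [Hm [Hnm He]]]; apply (Hle n m); auto.
    rewrite <- He; apply Hx', HG; eauto.
  (* Here the levels are constant from some n on, and density of that one level suffices. *)
  - apply NNPP; intro Hno; apply Hs; intros n Hn; apply NNPP; intro Hc.
    apply Hno; destruct (level_dense X T Ht F HF H1 H2 n W Hn HW HWe) as [x [Hx Hxn]].
    exists x; split; auto; intros k Hk; fold L in Hxn |- *.
    destruct (nat_tricho k n Hk Hn) as [H|[->|H]]; auto.
    + apply (Hle k n); auto.
    + replace (L k) with (L n); auto; apply NNPP; intro Hne; apply Hc; eauto.
Qed.

End Model.

(** * Models of ZF *)

Lemma sat_sapp (M : Type) (E : M -> M -> Prop) r d A l :
  sat E r (sapp A l d) <-> sat E (fun i => match nth_error l i with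
    | Some x => r (idx d x) | None => r (d + (i - length l)) end) A.
Proof.
  unfold sapp; rewrite sat_ren; apply sat_ext; intro i.
  destruct (nth_error l i); reflexivity.
Qed.

Lemma model_separation (M : Type) (E : M -> M -> Prop) (c : nat -> M) :
  (forall A r, sat E r (univ_closure (ax_separation A 0))) ->
  forall P, Def1 M E c P -> forall a, exists b, forall x, E x b <-> E x a /\ P x.
Proof.
  intros H P [A HA] a.
  (* All arguments become the element, index 0. Parameter i moves to index i + 2, past the two
     indices that the schema reserves for the element and the set, and is then read in the
     environment [c]. *)
  set (A' := ren (interleave (fun _ => 0) (fun i => S (S i))) A).
  assert (HA' := sat_univ_closure E _ (H A') c).
  assert (Hs : sat E c (ax_separation A' 0) <->
    forall a, exists b, forall x, E x b <-> E x a /\ P x).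
  { apply sat_sAll; intro u; apply sat_sEx; intro b; apply sat_sAll; intro x.
    apply sat_sIff; [|apply sat_sAnd]; try (apply sat_sMem; split; auto).
    rewrite sat_sapp; unfold A'; rewrite sat_ren, (HA (fun _ => x)).
    apply sat_ext; intro i.
    unfold interleave; destruct (Nat.even i); [reflexivity|].
    generalize (Nat.div2 i); intro j; simpl; destruct j; simpl; f_equal; lia. }
  apply Hs, HA'.
Qed.

Lemma ZF_closed B : ZF B -> fvbound B = 0.
Proof. intros []; try reflexivity; apply fvbound_univ_closure. Qed.

Lemma ZF_proves_case (A : sform) :
  fvbound (A 0) = 0 ->
  (forall (M : Type) (E : M -> M -> Prop) (c : nat -> M),
    (forall x, exists n, c n = x) ->
    (forall x y, (forall z, E z x <-> E z y) -> x = y) ->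
    (forall x y, exists p, IsPair M E p x y) ->
    (forall x, exists u, IsUnion M E u x) ->
    (forall x, exists p, IsPower M E p x) ->
    (exists w, IsInductive M E w) ->
    (forall P, Def1 M E c P ->
       forall a, exists b, forall x, E x b <-> E x a /\ P x) ->
    forall r, sat E r (A 0)) ->
  ZF_proves A.
Proof.
  intros HA H; apply (completeness ZF (A 0)); auto.
  { intros B HB; rewrite ZF_closed by exact HB; auto. }
  intros M E c Hc HZ r; apply (H M E c); auto.
  - apply (sat_extensionality M E r), HZ, ZF_extensionality.
  - apply (sat_pairing M E r), HZ, ZF_pairing.
  - apply (sat_union M E r), HZ, ZF_union.
  - apply (sat_power M E r), HZ, ZF_power.
  - apply (sat_infinity M E r), HZ, ZF_infinity.
  - apply model_separation; intros B s; apply HZ, ZF_separation.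
Qed.

Theorem theorem4p6 :
  ZF_proves (IQDI ⇒ well_orderable_dense_case)
  /\ ZF_proves (IQDI ⇒ baire_case)
  /\ ZF_proves (IQDI ⇒ infinite_Clop_case)
  /\ ZF_proves (IQDI ⇒ zero_dimensional_case).
Proof.
  repeat split; (apply ZF_proves_case; [reflexivity|]);
    intros M E c Hc He Hp Hu Hw Hi Hs r.
  - apply (sat_sImp M E r 0 _ _ _ _ (sat_IQDI M E r 0)
      (sat_well_orderable_dense_case M E r 0)).
    apply (well_orderable_dense_case_holds M E c); auto.
  - apply (sat_sImp M E r 0 _ _ _ _ (sat_IQDI M E r 0) (sat_baire_case M E r 0)).
    apply (baire_case_holds M E c); auto.
  - apply (sat_sImp M E r 0 _ _ _ _ (sat_IQDI M E r 0)
      (sat_infinite_Clop_case M E r 0)).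
    apply (infinite_Clop_case_holds M E c); auto.
  - apply (sat_sImp M E r 0 _ _ _ _ (sat_IQDI M E r 0)
      (sat_zero_dimensional_case M E r 0)).
    apply (zero_dimensional_case_holds M E c); auto.
Qed.
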